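(* For every integer $k\ge 2$ there exist an integer $n\ge 2k$, an integer $m>2$, and convex bodies $K_1,\ldots,K_m,C_1,\ldots,C_{n-2k}$ in $\mathbb{R}^n$ such that the $m\times m$ symmetric matrix $\mathrm{M}$ defined by $$\mathrm{M}_{ij} := \mathsf{V}(K_i[k],K_j[k],C_1,\ldots,C_{n-2k})$$ satisfies $$(-1)^m\det\mathrm{M} > 0.$$ In other words, the inequality $(-1)^m\det \mathrm{M}\le 0$ (Fedotov's conjecture) fails for every $k>1$ for some $m>2$.
   Context: A convex body is a nonempty compact convex subset of $\mathbb{R}^n$. Mixed volumes $\mathsf{V}(L_1,\ldots,L_n)$ of convex bodies in $\mathbb{R}^n$ are the unique symmetric coefficients such that $\mathrm{Vol}(\lambda_1L_1+\cdots+\lambda_rL_r)=\sum_{i_1,\ldots,i_n=1}^r \mathsf{V}(L_{i_1},\ldots,L_{i_n})\lambda_{i_1}\cdots\lambda_{i_n}$ for all $\lambda_1,\ldots,\lambda_r>0$ (Minkowski addition). The notation $\mathsf{V}(L_1[m_1],\ldots,L_r[m_r])$ means the mixed volume in which $L_j$ is repeated $m_j$ times, $\sum_j m_j=n$. *)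

(* Defs.v *)
From HB Require Import structures.
From mathcomp Require Import all_boot all_order all_algebra perm.
From mathcomp Require Import all_classical all_reals all_analysis.
Set Implicit Arguments. Unset Strict Implicit. Unset Printing Implicit Defensive.
Import Order.TTheory GRing.Theory Num.Theory.
Import numFieldNormedType.Exports.
Local Open Scope classical_set_scope.
Local Open Scope ring_scope.

Section MixedVolumes.
Variables (R : realType) (n : nat).
Implicit Types (A : set 'rV[R]_n).

Definition box (a b : 'rV[R]_n) : set 'rV[R]_n :=
  [set x | forall i, a 0 i <= x 0 i <= b 0 i].

Definition box_vol (a b : 'rV[R]_n) : R := \prod_i Num.max (b 0 i - a 0 i) 0.

Definition lebesgue_outer A : \bar R :=
  ereal_inf [set (\sum_(0 <= k <oo) (box_vol (ab.1 k) (ab.2 k))%:E)%E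
            | ab in [set ab : (nat -> 'rV[R]_n) * (nat -> 'rV[R]_n)
                     | A `<=` \bigcup_k box (ab.1 k) (ab.2 k)]].

(* volume (finite for compact sets) *)
Definition Vol A : R := fine (lebesgue_outer A).

Definition convex_set A : Prop :=
  forall x y, A x -> A y -> forall t : R, 0 <= t <= 1 -> A (t *: x + (1 - t) *: y).

Definition convex_body A : Prop := A !=set0 /\ compact A /\ convex_set A.

Definition minkowski_comb (r : nat) (lam : 'I_r -> R) (L : 'I_r -> set 'rV[R]_n)
  : set 'rV[R]_n :=
  [set x | exists y : 'I_r -> 'rV[R]_n, (forall i, L i (y i)) /\ x = \sum_i lam i *: y i].

Definition is_mixed_volume (V : ('I_n -> set 'rV[R]_n) -> R) : Prop :=
  (forall (L : 'I_n -> set 'rV[R]_n) (s : {perm 'I_n}),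
      (forall i, convex_body (L i)) -> V (fun i => L (s i)) = V L) /\
  (forall (r : nat) (L : 'I_r -> set 'rV[R]_n) (lam : 'I_r -> R),
      (forall i, convex_body (L i)) -> (forall i, 0 < lam i) ->
      Vol (minkowski_comb lam L) =
      \sum_(f : {ffun 'I_n -> 'I_r}) V (fun j => L (f j)) * \prod_j lam (f j)).

Definition mv_args (k : nat) (A B : set 'rV[R]_n) (C : 'I_(n - 2 * k) -> set 'rV[R]_n)
  : 'I_n -> set 'rV[R]_n :=
  fun j => if (j < k)%N then A else if (j < 2 * k)%N then B
           else oapp C set0 (insub (j - 2 * k)%N).

End MixedVolumes.

(* Main.v *)
(* Existence of mixed volumes.  For polytopes [P_i = conv {v_t | g t = i}] choose generic costs
   [c_t].  By linear programming duality almost every point of [sum_i lam_i P_i] lies in exactly one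
   cell [{sum_(t in B) y_t v_t | y_t > 0, sum_(g t = i) y_t = lam_i}], where [B] ranges over the lower
   simplices of the Cayley configuration [(v_t, e_(g t))] lifted by [c].  The list of these [B] does
   not depend on [lam], and each cell is an affine image of a product of simplices scaled by the
   [lam_i], so its volume is a monomial of degree [n] in [lam].  Hence volume is polynomial on sums of
   polytopes; bodies follow by outer approximation, since polarization expresses the coefficients
   through finitely many volumes, each of which passes to the limit.

   Counterexample.  Take [n = 2k], so that no [C_l] occurs, and let the [K_i] be the coordinate unit
   cubes on [S], its complement, [T] and its complement, where [S] and [T] are [k]-sets of coordinates
   with [T] different from [S] and its complement (possible because [k >= 2]).  The mixed volume of
   two such cubes is a fixed positive number if their coordinate sets are complementary, and 0
   otherwise, so [M] is a positive multiple of the permutation matrix of a double transposition. *)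
Require Import Defs.
From HB Require Import structures.
From mathcomp Require Import all_boot all_order all_algebra perm.
From mathcomp Require Import all_classical all_reals all_analysis.
From mathcomp Require Import measurable_realfun ring lra.
Set Implicit Arguments. Unset Strict Implicit. Unset Printing Implicit Defensive.
Import Order.TTheory GRing.Theory Num.Theory.
Import numFieldNormedType.Exports.
Local Open Scope classical_set_scope.
Local Open Scope ring_scope.

(** * Lebesgue outer measure *)

(** The volume is an outer measure given by countable box covers, so scaling, additivity and passage
    to the limit are all derived from covers. Dimensions have the form [n.+1]: in dimension 0 every
    box has volume 1 and even [set0] has infinite outer measure. The monomials in [lam] come from
    diagonal maps alone; a general matrix contributes a factor independent of [lam]. The limit
    argument meets one obstacle: polarization evaluates volumes at 0/1 weights, whereas the polytope
    formula is proved for positive weights. All weights are therefore shifted by [k.+1%:R^-1], which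
    is harmless because the polarization identity tolerates any constant shift. The coefficients of
    the approximating forms are not symmetric and need not converge, so polarization is applied to
    each form before the limit, and only finitely many values have to converge. Existence of mixed
    volumes is part of the final statement because the claim about every [V] could otherwise be
    vacuous. *)

Definition leb (R : realType) (n : nat) : set 'rV[R]_n.+1 -> \bar R :=
  @lebesgue_outer R n.+1.

Lemma box_vol_ge0 (R : realType) (n : nat) (a b : 'rV[R]_n) : 0 <= box_vol a b.
Proof. by apply: prodr_ge0 => i _; rewrite le_max lexx orbT. Qed.

Section OuterMeasure.
Variables (R : realType) (n : nat).
Implicit Types (A E : set 'rV[R]_n.+1) (a b x : 'rV[R]_n.+1).
Local Notation mu := (@leb R n).

Lemma leb_le_cover A (ab : nat -> 'rV[R]_n.+1 * 'rV[R]_n.+1) :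
  A `<=` \bigcup_k box (ab k).1 (ab k).2 ->
  (mu A <= \sum_(0 <= k <oo) (box_vol (ab k).1 (ab k).2)%:E)%E.
Proof.
move=> cA; apply: ereal_inf_lbound.
exists ((fun k => (ab k).1), (fun k => (ab k).2)) => //=.
Qed.

Lemma leb_ge0 A : (0 <= mu A)%E.
Proof.
apply: le_ereal_inf_tmp => _ [ab _ <-].
by apply: nneseries_ge0 => k _ _; rewrite lee_fin box_vol_ge0.
Qed.

Lemma leb_le A E : A `<=` E -> (mu A <= mu E)%E.
Proof.
move=> AE; apply: ereal_inf_le_tmp => _ [ab cE <-]; exists ab => //.
exact: subset_trans AE cE.
Qed.

Lemma box_vol_eq0 a b i : b 0 i <= a 0 i -> box_vol a b = 0.
Proof.
move=> h; rewrite /box_vol (bigD1 i) //= max_r ?mul0r //.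
by rewrite subr_le0.
Qed.

Lemma leb_box_le a b : (mu (box a b) <= (box_vol a b)%:E)%E.
Proof.
(* The box itself followed by copies of the degenerate box [(0, 0)], of volume 0 in positive
   dimension. *)
have := @leb_le_cover (box a b) (fun k => if k == 0%N then (a, b) else (0, 0)).
move/(_ _)/le_trans; apply; first by move=> x hx; exists 0%N.
rewrite (nneseries_split 0 1) => [|k _]; last by rewrite lee_fin box_vol_ge0.
rewrite big_nat1 eseries0 ?adde0 //= => -[//|k] _ _.
by rewrite /= (@box_vol_eq0 _ _ ord0).
Qed.

Lemma leb0 : mu set0 = 0%E.
Proof.
apply/eqP; rewrite eq_le leb_ge0 andbT.
apply: le_trans (@leb_le _ (box (0 : 'rV_n.+1) 0) _) _ => //.
by apply: le_trans (leb_box_le _ _) _; rewrite (@box_vol_eq0 _ _ ord0).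
Qed.

Lemma leb_cover_adherent A (e : R) : 0 < e -> mu A \is a fin_num ->
  exists2 ab : nat -> 'rV[R]_n.+1 * 'rV[R]_n.+1,
    A `<=` \bigcup_k box (ab k).1 (ab k).2 &
    (\sum_(0 <= k <oo) (box_vol (ab k).1 (ab k).2)%:E <= mu A + e%:E)%E.
Proof.
move=> e0 finA; have [_ [ab cA <-] le] := lb_ereal_inf_adherent e0 finA.
by exists (fun k => (ab.1 k, ab.2 k)) => //; exact: ltW.
Qed.

Lemma leb_sigma_subadditive : sigma_subadditive mu.
Proof.
move=> A; have [[i ioo]|nooA] := pselect (exists i, mu (A i) = +oo%E).
  rewrite (eseries_pinfty _ _ ioo) ?leey// => k _.
  by rewrite -ltNye (lt_le_trans _ (leb_ge0 _)).
apply/lee_addgt0Pr => e e0.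
apply: le_trans (epsilon_trick _ _ (ltW e0)); last by move=> k; exact: leb_ge0.
have finA k : mu (A k) \is a fin_num.
  rewrite ge0_fin_numE ?leb_ge0 // ltey; apply/eqP => h.
  by apply: nooA; exists k.
have ek k : 0 < e / (2 ^ k.+1)%:R by rewrite divr_gt0 // ltr0n expn_gt0.
have /choice[G PG] : forall k, exists ab : nat -> 'rV[R]_n.+1 * 'rV[R]_n.+1,
    A k `<=` \bigcup_j box (ab j).1 (ab j).2 /\
    (\sum_(0 <= j <oo) (box_vol (ab j).1 (ab j).2)%:E
       <= mu (A k) + (e / (2 ^ k.+1)%:R)%:E)%E.
  by move=> k; have [ab ? ?] := leb_cover_adherent (ek k) (finA k); exists ab.
(* A bijection between [nat] and pairs turns the family of covers into a single sequence of
   boxes. *)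
have /card_esym/ppcard_eqP[f] := card_nat2.
pose v (p : nat * nat) : \bar R := (box_vol (G p.1 p.2).1 (G p.1 p.2).2)%:E.
have v0 p : (0 <= v p)%E by rewrite lee_fin box_vol_ge0.
apply: (@le_trans _ _ (\sum_(0 <= k <oo) v (f k))%E).
  apply: (@leb_le_cover _ (fun k => G (f k).1 (f k).2)) => x [i _ Aix].
  have [j _ xj] := (PG i).1 _ Aix.
  by exists (f^-1%FUN (i, j)) => //=; rewrite invK ?inE.
have -> : (\sum_(0 <= k <oo) v (f k) = \sum_(0 <= i <oo) \sum_(0 <= j <oo) v (i, j))%E.
  rewrite nneseries_esumT // -(@reindex_esum _ _ _ setT setT f v) //; last first.
  rewrite (nneseries_esumT (a := fun i => (\sum_(0 <= j <oo) v (i, j))%E)); last first.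
    by move=> i; apply: nneseries_ge0.
  under [RHS]eq_esum do rewrite nneseries_esumT //.
  rewrite (@esum_esum _ _ _ setT (fun=> setT) (fun i j => v (i, j))) //.
  by apply: congr2; [apply/seteqP; split => // | apply/funext => -[]].
by apply: lee_nneseries => k _ => [_|]; [exact: nneseries_ge0 | exact: (PG k).2].
Qed.

(** Makes the Carathéodory sigma-algebra of [leb] available; the cells are shown to belong to it. *)
HB.instance Definition _ := isOuterMeasure.Build R 'rV[R]_n.+1 (@leb R n)
  leb0 leb_ge0 leb_le leb_sigma_subadditive.

End OuterMeasure.

(** * The outer measure of a box is its volume *)

Lemma integral_cst_indic_itv (R : realType) (p a b : R) : 0 <= p ->
  (\int[lebesgue_measure]_t (p * \1_(`[a, b]%classic : set R) t)%:E
     = (p * Num.max (b - a) 0)%:E)%E.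
Proof.
move=> p0; under eq_integral do rewrite EFinM.
rewrite ge0_integralZl_EFin //=; last first.
  by apply/measurable_EFinP; apply: measurable_indic.
rewrite integral_indic // setIT EFinM.
rewrite [X in (_ * X)%E](lebesgue_measure_itv `[a, b]) /= lte_fin; congr (_ * _)%E.
case: ifPn => [ab|]; first by rewrite max_l // subr_ge0 ltW.
by rewrite -leNgt => ba; rewrite max_r // subr_le0.
Qed.

(** One integration step of the lower bound for boxes. The weights [p] and [q k] stand for the
    factors of the other coordinates; integrating the pointwise inequality in [t] and exchanging
    series and integral gives the claim. *)
Lemma cover_itv_le (R : realType) (p a b : R) (q c d : nat -> R) :
  0 <= p -> (forall k, 0 <= q k) ->
  (forall t, (p * \1_(`[a, b]%classic : set R) t)%:E <=
     \sum_(0 <= k <oo) (q k * \1_(`[c k, d k]%classic : set R) t)%:E)%E ->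
  ((p * Num.max (b - a) 0)%:E <=
     \sum_(0 <= k <oo) (q k * Num.max (d k - c k) 0)%:E)%E.
Proof.
move=> p0 q0 h; rewrite -integral_cst_indic_itv //.
have m (r u v : R) : measurable_fun [set: R]
    (fun t : R => (r * \1_(`[u, v]%classic : set R) t)%:E).
  by apply/measurable_EFinP; apply: measurable_funM => //; exact: measurable_indic.
have g0 (r u v t : R) : 0 <= r -> (0 <= (r * \1_(`[u, v]%classic : set R) t)%:E)%E.
  by move=> r0; rewrite lee_fin mulr_ge0.
have -> : (\sum_(0 <= k <oo) (q k * Num.max (d k - c k) 0)%:E =
   \int[lebesgue_measure]_t
     \sum_(0 <= k <oo) (q k * \1_(`[c k, d k]%classic : set R) t)%:E)%E.
  rewrite integral_nneseries //=; [|by move=> k; exact: m|by move=> k t _; exact: g0].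
  by apply: eq_eseriesr => k _; rewrite integral_cst_indic_itv.
apply: ge0_le_integral => //.
- by move=> t _; exact: g0.
- exact: m.
- by apply: (ge0_emeasurable_sum (P := predT)) => k *; [exact: g0|exact: m].
Qed.

Section BoxVolume.
Variables (R : realType) (n : nat).
Implicit Types (a b x : 'rV[R]_n.+1).
Local Notation mu := (@leb R n).

(* Fubini one coordinate at a time: coordinates below [j] have already been integrated out. *)
Let w (j : nat) a b x (i : 'I_n.+1) : R :=
  if (i < j)%N then Num.max (b 0 i - a 0 i) 0
  else \1_(`[a 0 i, b 0 i]%classic : set R) (x 0 i).

Let w_ge0 j a b x i : 0 <= w j a b x i.
Proof. by rewrite /w; case: ifP => _; [rewrite le_max lexx orbT|]. Qed.

Let upd x (j : 'I_n.+1) (t : R) : 'rV[R]_n.+1 :=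
  \row_i (if i == j then t else x 0 i).

Let w_upd (j : 'I_n.+1) a b x t : \prod_i w j a b (upd x j t) i =
  (\prod_(i | i != j) w j a b x i) * \1_(`[a 0 j, b 0 j]%classic : set R) t.
Proof.
rewrite (bigD1 j) //= mulrC; congr (_ * _); last by rewrite /w ltnn !mxE eqxx.
by apply: eq_bigr => i ij; rewrite /w mxE (negbTE ij).
Qed.

Let w_succ (j : 'I_n.+1) a b x : \prod_i w j.+1 a b x i =
  (\prod_(i | i != j) w j a b x i) * Num.max (b 0 j - a 0 j) 0.
Proof.
rewrite (bigD1 j) //= mulrC; congr (_ * _); last by rewrite /w ltnSn.
apply: eq_bigr => i ij; rewrite /w ltnS leq_eqVlt.
by rewrite (_ : (i == j :> nat) = false) //; apply/negbTE.
Qed.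

(** Induction on the number of integrated coordinates: at stage 0 the claim is the covering
    hypothesis written with indicators, at stage [n.+1] it compares volumes. Working with series
    avoids extracting a finite subcover. *)
Lemma box_vol_le_cover a b (ab : nat -> 'rV[R]_n.+1 * 'rV[R]_n.+1) :
  box a b `<=` \bigcup_k box (ab k).1 (ab k).2 ->
  ((box_vol a b)%:E <= \sum_(0 <= k <oo) (box_vol (ab k).1 (ab k).2)%:E)%E.
Proof.
move=> cov.
suff H j : (j <= n.+1)%N -> forall x, ((\prod_i w j a b x i)%:E <=
   \sum_(0 <= k <oo) (\prod_i w j (ab k).1 (ab k).2 x i)%:E)%E.
  have E c d : box_vol c d = \prod_i w n.+1 c d 0 i.
    by apply: eq_bigr => i _; rewrite /w ltn_ord.
  rewrite E; under eq_eseriesr do rewrite E.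
  exact: H.
elim: j => [_ x|j IH jn x].
  have [/= xab|/= xab] := pselect (box a b x).
    have [k _ xk] := cov _ xab.
    apply: (@le_trans _ _ (\prod_i w 0 (ab k).1 (ab k).2 x i)%:E).
      rewrite lee_fin [leRHS]big1 => [|i _]; last first.
        rewrite /w ltn0 indicE mem_set //.
        by rewrite /= in_itv; exact: xk.
      apply: prodr_ile1 => i _.
      by rewrite w_ge0 /= /w ltn0 indicE; case: (_ \in _); rewrite ?lexx ?ler01.
    rewrite (@nneseriesD1 _ _ k) //= ?leeDl //.
      by apply: nneseries_ge0 => i _ _; rewrite lee_fin prodr_ge0.
    by move=> i; rewrite lee_fin prodr_ge0.
  rewrite (_ : \prod_i _ = 0); first by
    apply: nneseries_ge0 => k _ _; rewrite lee_fin prodr_ge0.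
  have /existsNP[i hi] := xab.
  rewrite (bigD1 i) //= {1}/w ltn0 indicE memNset ?mul0r //.

pose jo := Ordinal jn.
rewrite (w_succ jo); under eq_eseriesr do rewrite (w_succ jo).
apply: cover_itv_le => [|k|t]; [exact: prodr_ge0 | exact: prodr_ge0 |].
rewrite -w_upd; under eq_eseriesr do rewrite -w_upd.
exact: (IH (ltnW jn)).
Qed.

Lemma leb_box a b : mu (box a b) = (box_vol a b)%:E.
Proof.
apply/eqP; rewrite eq_le leb_box_le /=.
apply: le_ereal_inf_tmp => _ [ab cov <-].
exact: (@box_vol_le_cover a b (fun k => (ab.1 k, ab.2 k))).
Qed.

End BoxVolume.

(** * Linear images and measurable polyhedra *)

Definition bnd (R : realType) (n : nat) (E : set 'rV[R]_n) : Prop :=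
  exists r : R, E `<=` box (const_mx (- r)) (const_mx r).

Section LinearImages.
Variables (R : realType) (n : nat).
Implicit Types (A E : set 'rV[R]_n.+1) (a b x v : 'rV[R]_n.+1).
Local Notation mu := (@leb R n).

Lemma leb_bnd_fin E : bnd E -> mu E \is a fin_num.
Proof.
move=> [r Er]; rewrite ge0_fin_numE ?leb_ge0 //.
by apply: le_lt_trans (leb_le Er) _; rewrite leb_box ltry.
Qed.

Lemma leb_image_le (f : 'rV[R]_n.+1 -> 'rV[R]_n.+1) (c : R) E :
  0 <= c -> mu E \is a fin_num ->
  (forall a b, (mu (f @` box a b) <= (c * box_vol a b)%:E)%E) ->
  (mu (f @` E) <= c%:E * mu E)%E.
Proof.
move=> c0 finE h; apply/lee_addgt0Pr => e e0.
(* The denominator is [c + 1] because [c] may be 0. *)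
have d0 : 0 < e / (c + 1) by rewrite divr_gt0 // ltr_wpDl.
have [ab cov le] := leb_cover_adherent d0 finE.
apply: (@le_trans _ _ (c%:E * (mu E + (e / (c + 1))%:E))%E); last first.
  rewrite ge0_muleDr ?leb_ge0 ?lee_fin ?(ltW d0) //.
  rewrite leeD2l // -EFinM lee_fin mulrCA ger_pMr // ler_pdivrMr ?ltr_wpDl //.
  by rewrite mul1r lerDl.
apply: le_trans (lee_wpmul2l _ le); last by rewrite lee_fin.
rewrite -nneseriesZl; last by move=> k _; rewrite lee_fin box_vol_ge0.
apply: (@le_trans _ _ (mu (\bigcup_k f @` box (ab k).1 (ab k).2))).
  apply: leb_le => _ [x /cov[k _ xk] <-]; exists k => //; exact: imageP.
apply: le_trans (leb_sigma_subadditive _) _.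
apply: lee_nneseries => [k _ _|k _]; first exact: leb_ge0.
by rewrite -EFinM h.
Qed.

Lemma leb_translate_le E v : mu E \is a fin_num ->
  (mu [set (x + v)%R | x in E] <= mu E)%E.
Proof.
move=> finE; rewrite -[leRHS]mul1e; apply: leb_image_le => // a b.
rewrite mul1r (_ : box_vol a b = box_vol (a + v) (b + v)); last first.
  by apply: eq_bigr => i _; rewrite !mxE opprD addrACA subrr addr0.
rewrite -leb_box; apply: leb_le => _ [x xab <-] i.
by rewrite !mxE !lerD2r xab.
Qed.

Lemma bnd_translate E v : bnd E -> bnd [set x + v | x in E].
Proof.
move=> [r Er]; exists (r + \sum_i `|v 0 i|) => _ [x xE <-] i.
have := Er _ xE i; rewrite !mxE => /andP[h1 h2].
have : `|v 0 i| <= \sum_i `|v 0 i| by rewrite (bigD1 i) //= lerDl sumr_ge0.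
by rewrite ler_norml => /andP[h3 h4]; apply/andP; split; lra.
Qed.

Lemma leb_translate E v : bnd E -> mu [set x + v | x in E] = mu E.
Proof.
move=> bE; apply/eqP; rewrite eq_le leb_translate_le ?leb_bnd_fin //=.
have := @leb_translate_le [set x + v | x in E] (- v).
move/(_ (leb_bnd_fin (bnd_translate v bE))); apply: le_trans.
by apply: leb_le => x xE; exists (x + v); [exists x | rewrite addrK].
Qed.

Lemma leb_diag_le E (d : 'rV[R]_n.+1) : (forall i, 0 <= d 0 i) ->
  mu E \is a fin_num ->
  (mu [set x *m diag_mx d | x in E] <= (\prod_i d 0 i)%:E * mu E)%E.
Proof.
move=> d0 finE; apply: leb_image_le => // [|a b]; first exact: prodr_ge0.
rewrite (_ : _ * _ = box_vol (a *m diag_mx d) (b *m diag_mx d)); last first.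
  rewrite -big_split; apply: eq_bigr => i _.
  by rewrite !mul_mx_diag !mxE /= maxr_pMr // mulr0 mulrC mulrBl.
rewrite -leb_box; apply: leb_le => _ [x xab <-] i.
by rewrite !mul_mx_diag !mxE !ler_wpM2r ?(andP (xab i)).1 ?(andP (xab i)).2.
Qed.

Lemma bnd_mulmx E (M : 'M[R]_n.+1) : bnd E -> bnd [set x *m M | x in E].
Proof.
move=> [r Er]; exists (\sum_i \sum_j `|r| * `|M j i|) => _ [x xE <-] i.
rewrite !mxE -ler_norml; apply: le_trans (ler_norm_sum _ _ _) _.
apply: (@le_trans _ _ (\sum_j `|r| * `|M j i|)); last first.
  rewrite [leRHS](bigD1 i) //= lerDl; apply: sumr_ge0 => k _.
  by apply: sumr_ge0 => j _; rewrite mulr_ge0.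
apply: ler_sum => j _; rewrite normrM ler_wpM2r //.
have := Er _ xE j; rewrite !mxE -ler_norml => /le_trans; apply.
exact: ler_norm.
Qed.

Lemma leb_diag E (d : 'rV[R]_n.+1) : (forall i, 0 < d 0 i) -> bnd E ->
  (mu [set x *m diag_mx d | x in E] = (\prod_i d 0 i)%:E * mu E)%E.
Proof.
move=> d0 bE; apply/eqP; rewrite eq_le leb_diag_le ?leb_bnd_fin //=; last first.
  by move=> i; exact/ltW.
pose d' : 'rV[R]_n.+1 := \row_i (d 0 i)^-1.
have P0 : 0 < \prod_i d 0 i by exact: prodr_gt0.
rewrite -(@lee_pdivlMl _ (\prod_i d 0 i)) //.
have -> : (\prod_i d 0 i)^-1 = \prod_i d' 0 i.
  by rewrite -prodfV; apply: eq_bigr => i _; rewrite mxE.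
apply: le_trans (leb_diag_le _ _); last 2 first.
- by move=> i; rewrite mxE invr_ge0 ltW.
- by apply: leb_bnd_fin; exact: bnd_mulmx.
apply: leb_le => x xE; exists (x *m diag_mx d); first by exists x.
apply/rowP => i; rewrite !mul_mx_diag !mxE mulfK //.
by rewrite gt_eqF.
Qed.

(* Cutting a box by a coordinate hyperplane splits its volume exactly. *)
Lemma caratheodory_coord_le i (t : R) :
  (@leb R n).-caratheodory [set x | x 0 i <= t].
Proof.
apply: le_caratheodory_measurable => X.
have [finX|] := boolP (mu X \is a fin_num); last first.
  rewrite ge0_fin_numE ?leb_ge0 // -leNgt leye_eq => /eqP h.
  by rewrite [leRHS]h leey.
apply/lee_addgt0Pr => e e0.
have [ab cov le] := leb_cover_adherent e0 finX.
apply: le_trans le.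
set A := [set x | _].
apply: (@le_trans _ _ (\sum_(0 <= k <oo) (mu (box (ab k).1 (ab k).2 `&` A) +
   mu (box (ab k).1 (ab k).2 `&` ~` A)))%E).
  rewrite nneseriesD => [|k _ _|k _ _]; [|exact: leb_ge0|exact: leb_ge0].
  by apply: leeD; (apply: le_trans (leb_sigma_subadditive _);
    apply: leb_le => x [/cov[k _ xk] xA]; exists k).
apply: lee_nneseries => [k _ _|k _]; first by rewrite adde_ge0 ?leb_ge0.
case: (ab k) => a b /=.
pose a' : 'rV[R]_n.+1 := \row_j (if j == i then Num.max (a 0 j) t else a 0 j).
pose b' : 'rV[R]_n.+1 := \row_j (if j == i then Num.min (b 0 j) t else b 0 j).
apply: (@le_trans _ _ ((box_vol a b')%:E + (box_vol a' b)%:E)%E).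
  rewrite -!leb_box; apply: leeD; apply: leb_le => x [xab xA] j.
    rewrite mxE; case: eqP => [->|_]; last exact: xab.
    by rewrite le_min (andP (xab i)).1 (andP (xab i)).2 /=; exact: xA.
  rewrite mxE; case: eqP => [->|_]; last exact: xab.
  rewrite ge_max (andP (xab i)).1 (andP (xab i)).2 /= andbT ltW // ltNge.
  exact/negP.
rewrite -EFinD lee_fin /box_vol !(bigD1 i (P := xpredT)) //= !mxE eqxx.
under [X in _ * X + _]eq_bigr => j ji do rewrite !mxE (negbTE ji).
under [X in _ + _ * X]eq_bigr => j ji do rewrite !mxE (negbTE ji).
rewrite -mulrDl ler_wpM2r //; first by apply: prodr_ge0 => j _; rewrite le_max lexx orbT.
by rewrite /Num.max /Num.min; repeat case: ifPn => ?; lra.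
Qed.

Lemma measurable_coord i :
  measurable_fun [set: caratheodory_type (@leb R n)]
    (fun x : caratheodory_type (@leb R n) => (x : 'rV[R]_n.+1) 0 i).
Proof.
apply: (measurability _ (RGenOInfty.measurableE R)) => _ [_ [t ->] <-].
rewrite setTI.
have := caratheodory_measurable_setC (caratheodory_coord_le i t).
congr (caratheodory_measurable _ _).
by apply/seteqP; split => x /=; rewrite in_itv /= andbT ltNge => /negP.
Qed.

Definition lform (u x : 'rV[R]_n.+1) : R := \sum_i x 0 i * u 0 i.

Lemma measurable_lform u : measurable_fun [set: caratheodory_type (@leb R n)]
    (fun x : caratheodory_type (@leb R n) => lform u x).
Proof.
apply: measurable_sum => i; apply: measurable_funM => //.
exact: measurable_coord.
Qed.

Lemma caratheodory_lform_gt u (t : R) : (@leb R n).-caratheodory [set x | t < lform u x].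
Proof.
have := @measurable_lform u measurableT `]t, +oo[%classic (measurable_itv _).
rewrite setTI; congr (caratheodory_measurable _ _).
by apply/seteqP; split => x /=; rewrite in_itv /= andbT.
Qed.

End LinearImages.

(** Lengthening the sides of a box by [e] increases its volume at most linearly in [e]. In the
    induction the 2 absorbs the terms [e * y] and [e * (e * z)], each at most [e * z]. *)
Lemma prod_addr_le (R : realType) (I : finType) (w : I -> R) (e : R) :
  (forall i, 0 <= w i) -> 0 <= e <= 1 ->
  \prod_i (w i + e) <= \prod_i w i + e * \prod_i (w i + 2).
Proof.
move=> w0 /andP[e0 e1].
suff [//] : \prod_i (w i + e) <= \prod_i w i + e * \prod_i (w i + 2) /\
  0 <= \prod_i w i <= \prod_i (w i + 2).
apply: (big_rec3 (fun x y z => x <= y + e * z /\ 0 <= y <= z)).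
  by split; [rewrite mulr1 lerDl | rewrite ler01 lexx].
move=> i x y z _ [h /andP[y0 yz]]; have wi := w0 i; split; last first.
  rewrite mulr_ge0 //=; apply: ler_pM => //; lra.
apply: (@le_trans _ _ ((w i + e) * (y + e * z))).
  by apply: ler_wpM2l => //; apply: addr_ge0.
have ez : e * (e * z) <= e * z.
  by rewrite ler_wpM2l // ler_piMl // (le_trans y0).
have ey : e * y <= e * z by rewrite ler_wpM2l.
nra.
Qed.

Section LinearImages2.
Variables (R : realType) (n : nat).
Implicit Types (A E : set 'rV[R]_n.+1) (a b x v : 'rV[R]_n.+1) (M : 'M[R]_n.+1).
Local Notation mu := (@leb R n).

Lemma leb_fin_cover (I : finType) (P : pred I) A (F : I -> set 'rV[R]_n.+1) :
  (forall x, A x -> exists2 i, P i & F i x) -> (mu A <= \sum_(i | P i) mu (F i))%E.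
Proof.
move=> cov.
suff H (r : seq I) B : (forall x, B x -> exists i, [/\ i \in r, P i & F i x]) ->
    (mu B <= \sum_(i <- r | P i) mu (F i))%E.
  by apply: H => x /cov[i Pi Fi]; exists i; rewrite mem_index_enum.
elim: r B => [|i r IH] B covB.
  rewrite big_nil (_ : B = set0) ?leb0 //.
  by apply/seteqP; split => // x /covB[i []].
rewrite big_cons; case: ifPn => Pi; last first.
  apply: IH => x /covB[j [+ Pj Fj]]; rewrite inE => /predU1P[ji|jr].
    by rewrite -ji Pj in Pi.
  by exists j.
apply: (@le_trans _ _ (mu (F i `|` (B `\` F i)))).
  apply: leb_le => x Bx; have [Fx|Fx] := pselect (F i x); first by left.
  by right.
apply: le_trans (outer_measureU2 _ _ _) _; apply: leeD2l.
apply: IH => x [/covB[j [+ Pj Fj]] nF]; rewrite inE => /predU1P[ji|jr].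
  by case: nF; rewrite -ji.
by exists j.
Qed.

Local Notation cube := (box (0 : 'rV[R]_n.+1) (const_mx 1)).

(** This is the absolute value of the determinant, encoded as the measure of the image of the unit
    cube so that the scaling law can be proved by covering with cubes. *)
Definition mx_factor M : R := fine (mu [set x *m M | x in cube]).

Lemma bnd_box a b : bnd (box a b).
Proof.
exists (\sum_i (`|a 0 i| + `|b 0 i|)) => x xab i; rewrite !mxE -ler_norml.
rewrite (bigD1 i) //=; apply: ler_wpDr.
  by apply: sumr_ge0 => j _; rewrite addr_ge0.
have /andP[h1 h2] := xab i.
rewrite ler_norml; apply/andP; split.
  by have := ler_norm (- a 0 i); rewrite normrN; have := normr_ge0 (b 0 i); lra.
by have := ler_norm (b 0 i); have := normr_ge0 (a 0 i); lra.
Qed.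

Lemma mx_factorE M :
  mu [set x *m M | x in cube] = (mx_factor M)%:E.
Proof. by rewrite fineK // leb_bnd_fin //; apply/bnd_mulmx/bnd_box. Qed.

Lemma mx_factor_ge0 M : 0 <= mx_factor M.
Proof. by rewrite fine_ge0 // leb_ge0. Qed.

(** Scalar matrices commute with [M], so the image of a cube of side [s] is a scaled translate of
    the image of the unit cube. *)
Lemma leb_cube_mulmx_le M v (s : R) : 0 <= s ->
  (mu [set (v + s *: x)%R *m M | x in cube]
     <= (s ^+ n.+1 * mx_factor M)%:E)%E.
Proof.
move=> s0; rewrite EFinM -mx_factorE.
have bQ := bnd_mulmx M (bnd_box 0 (const_mx 1)).
have := @leb_diag_le _ _ _ (const_mx s) _ (leb_bnd_fin bQ).
move=> /(_ (fun i => _)); under eq_bigr do rewrite mxE.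
rewrite prodr_const card_ord => h.
apply: le_trans (h _); last by move=> i; rewrite mxE.
rewrite -(leb_translate (v *m M) (bnd_mulmx _ bQ)).
apply: leb_le => _ [x xQ <-].
exists (x *m M *m diag_mx (const_mx s)) => /=.
  by exists (x *m M) => //; exists x.
by rewrite diag_const_mx mul_mx_scalar mulmxDl scalemxAl addrC.
Qed.

(* Cover the box by cubes of side [s], whose images are translates of each other, and let [s]
   tend to 0. *)
Lemma leb_mulmx_box_le M a b :
  (mu [set x *m M | x in box a b] <= (mx_factor M * box_vol a b)%:E)%E.
Proof.
have c0 := mx_factor_ge0 M; set c := mx_factor M in c0 *.
pose w i := Num.max (b 0 i - a 0 i) 0.
have w0 i : 0 <= w i by rewrite le_max lexx orbT.
suff H (s : R) : 0 < s ->
    (mu [set x *m M | x in box a b] <= (c * \prod_i (w i + s))%:E)%E.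
  apply/lee_addgt0Pr => e e0.
  set C := \prod_i (w i + 2).
  have C0 : 0 <= C by apply: prodr_ge0 => i _; rewrite addr_ge0.
  have cC : 0 < c * C + 1 by rewrite ltr_wpDl // mulr_ge0.
  pose s := Num.min 1 (e / (c * C + 1)).
  have s0 : 0 < s by rewrite lt_min ltr01 divr_gt0.
  apply: le_trans (H s s0) _; rewrite -EFinD lee_fin.
  apply: (@le_trans _ _ (c * (\prod_i w i + s * C))).
    by rewrite ler_wpM2l // prod_addr_le // (ltW s0) ge_min lexx.
  rewrite mulrDr lerD2l mulrCA.
  have h : s * (c * C + 1) <= e by rewrite -ler_pdivlMr // ge_min lexx orbT.
  by apply: le_trans h; rewrite ler_wpM2l ?(ltW s0) // lerDl.
(* [K i] cubes of side [s] cover an edge of length [w i] and overshoot it by at most [s]. The common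
   bound [Km] lets one index type serve all axes. *)
move=> s0; pose K i := (Num.truncn (w i / s)).+1.
pose Km := \max_i K i.
have KKm i : (K i <= Km)%N by exact: leq_bigmax.
pose v (f : {ffun 'I_n.+1 -> 'I_Km}) : 'rV[R]_n.+1 :=
  \row_i (a 0 i + s * (f i)%:R).
pose Q i : pred 'I_Km := [pred j : 'I_Km | (j < K i)%N].
apply: (@le_trans _ _ (\sum_(f in family Q)
   mu [set (v f + s *: x)%R *m M | x in cube])%E).
  apply: leb_fin_cover => _ [x xab <-].
  have q0 i : 0 <= (x 0 i - a 0 i) / s.
    by rewrite divr_ge0 ?(ltW s0) // subr_ge0 (andP (xab i)).1.
  have tK i : (Num.truncn ((x 0 i - a 0 i) / s)%R < K i)%N.
    rewrite ltnS le_truncn // ler_pM2r ?invr_gt0 // le_max lerD2r.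
    by rewrite (andP (xab i)).2.
  pose f : {ffun 'I_n.+1 -> 'I_Km} := [ffun i => Ordinal (leq_trans (tK i) (KKm i))].
  exists f; first by apply/familyP => i; rewrite ffunE inE /=.
  exists (\row_i ((x 0 i - a 0 i) / s - (f i)%:R)).
    move=> i; rewrite !mxE ffunE /= subr_ge0.
    have /andP[h1 h2] := truncn_itv (q0 i).
    by rewrite h1 /= lerBlDl natr1 ltW.
  congr (_ *m _); apply/rowP => i; rewrite !mxE mulrBr mulrCA divff ?gt_eqF //.
  by rewrite mulr1; ring.
apply: (@le_trans _ _ (\sum_(f in family Q) (s ^+ n.+1 * c)%:E)%E).
  by apply: lee_sum => f _; apply: leb_cube_mulmx_le; exact: ltW.
rewrite sumEFin lee_fin -mulr_suml mulrC ler_wpM2l //.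
rewrite (eq_bigr (fun f : {ffun 'I_n.+1 -> 'I_Km} => \prod_(i < n.+1) s)); last first.
  by move=> f _; rewrite prodr_const card_ord.
rewrite -(bigA_distr_big_dep (fun i j => Q i j) (fun i j => s)).
apply: ler_prod => i _; rewrite sumr_ge0 => [|j _]; last exact: ltW.
rewrite -(big_ord_widen Km (fun=> s) (KKm i)) sumr_const card_ord.
rewrite -mulr_natr -natr1 mulrDr mulr1 lerD2r mulrC -ler_pdivlMr //.
by have /andP[] := @truncn_itv _ (w i / s) (divr_ge0 (w0 i) (ltW s0)).
Qed.

Lemma leb_mulmx_le M E : bnd E ->
  (mu [set x *m M | x in E] <= (mx_factor M)%:E * mu E)%E.
Proof.
move=> bE; apply: leb_image_le; [exact: mx_factor_ge0|exact: leb_bnd_fin|].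
exact: leb_mulmx_box_le.
Qed.

(** The unit cube is this cube shrunk by the factor [2 * r] and translated, and on the unit cube
    [mx_factor] is exact by definition. *)
Lemma leb_mulmx_cube M (r : R) : 0 < r ->
  ((mx_factor M)%:E * mu (box (const_mx (- r)%R) (const_mx r)) <=
   mu [set x *m M | x in box (const_mx (- r)%R) (const_mx r)])%E.
Proof.
move=> r0; set B := box _ _.
have bB : bnd [set x *m M | x in B] by apply/bnd_mulmx/bnd_box.
have i2r : 0 < (2 * r)^-1 by rewrite invr_gt0 mulr_gt0.
rewrite leb_box -mx_factorE muleC.
rewrite (_ : box_vol _ _ = (2 * r) ^+ n.+1); last first.
  rewrite /box_vol; under eq_bigr do rewrite !mxE.
  rewrite prodr_const card_ord max_l; last by lra.
  by congr (_ ^+ _); ring.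
rewrite -[leLHS]muleC -lee_pdivlMr; last by rewrite exprn_gt0 // -invr_gt0.
rewrite -exprVn.
have bB2 := bnd_mulmx (diag_mx (const_mx (2 * r)^-1)) bB.
have := @leb_diag_le _ _ _ (const_mx (2 * r)^-1) _ (leb_bnd_fin bB).
under eq_bigr do rewrite mxE.
rewrite prodr_const card_ord muleC => /(_ (fun i => _)) h.
apply: le_trans (h _); last by move=> i; rewrite mxE ltW.
rewrite -(leb_translate ((const_mx (1 / 2)) *m M) bB2).
apply: leb_le => _ [x xQ <-].
exists ((2 * r *: x - const_mx r) *m M *m diag_mx (const_mx (2 * r)^-1)).
  exists ((2 * r *: x - const_mx r) *m M) => //.
  exists (2 * r *: x - const_mx r) => // i.
  have := xQ i; rewrite !mxE => /andP[h1 h2]; apply/andP; split; nra.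
rewrite diag_const_mx mul_mx_scalar scalemxAl -mulmxDl; congr (_ *m _).
apply/rowP => i; rewrite !mxE; field.
by rewrite gt_eqF.
Qed.

(** The lower bound comes from complementation: inside a cube [B] containing [E], the factor is a
    lower bound for [B] and an upper bound for the part outside [E], and measurability of [E] makes
    the two parts of [B] add up. *)
Lemma leb_mulmx M E : bnd E -> (@leb R n).-caratheodory E ->
  (mu [set x *m M | x in E] = (mx_factor M)%:E * mu E)%E.
Proof.
move=> bE mE; apply/eqP; rewrite eq_le leb_mulmx_le //=.
have [r0 Er0] := bE; pose r := Num.max r0 1.
have r1 : 0 < r by rewrite lt_max ltr01 orbT.
pose B : set 'rV[R]_n.+1 := box (const_mx (- r)) (const_mx r).
have EB : E `<=` B.
  move=> x /Er0 + i => /(_ i); rewrite !mxE => /andP[h1 h2].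
  have rr : r0 <= r by rewrite le_max lexx.
  apply/andP; split; lra.
have bB : bnd B by exact: bnd_box.
have bBE : bnd (B `&` ~` E) by have [q Bq] := bB; exists q => x [/Bq].
have finBE : ((mx_factor M)%:E * mu (B `&` ~` E))%E \is a fin_num.
  by rewrite fin_numM // leb_bnd_fin.
suff : ((mx_factor M)%:E * mu E + (mx_factor M)%:E * mu (B `&` ~` E) <=
    mu [set x *m M | x in E] + (mx_factor M)%:E * mu (B `&` ~` E))%E.
  by rewrite leeD2rE.
rewrite -ge0_muleDr ?leb_ge0 //.
have -> : (mu E + mu (B `&` ~` E) = mu B)%E.
  by rewrite (mE B); congr (mu _ + _)%E; rewrite setIC; apply/esym/setIidPl.
apply: le_trans (leb_mulmx_cube _ r1) _.
apply: (@le_trans _ _ (mu ([set x *m M | x in E] `|`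
    [set x *m M | x in B `&` ~` E]))%E).
  apply: leb_le => _ [x xB <-]; have [xE|xE] := pselect (E x).
    by left; exists x.
  by right; exists x.
apply: le_trans (outer_measureU2 _ _ _) _; apply: leeD2l.
exact: leb_mulmx_le.
Qed.

(* The projection [M] along a coordinate axis transverse to the hyperplane fixes its points, so
   a bounded part of it lies in the image under [M] of a degenerate box. *)
Lemma leb_hyperplane u (t : R) E : u != 0 -> bnd E ->
  (forall x, E x -> lform u x = t) -> mu E = 0%E.
Proof.
move=> u0 bE Et.
have [k uk] : exists k, u 0 k != 0.
  apply/existsP; apply: contraNT u0 => /existsPn h.
  by apply/eqP/rowP => i; rewrite mxE; apply/eqP; have := h i; rewrite negbK.
pose p : 'rV[R]_n.+1 := (t / u 0 k) *: delta_mx 0 k.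
have lE x : x *m u^T = (lform u x)%:M.
  apply/matrixP => i j; rewrite !ord1 !mxE mulr1n.
  by apply: eq_bigr => l _; rewrite mxE.
have lp : p *m u^T = t%:M.
  by rewrite -scalemxAl -rowE; apply/matrixP => i j; rewrite !ord1 !mxE mulr1n divfK.
(* [x *m M] equals [x] minus [lform u x / u 0 k] times the [k]-th unit vector. *)
pose M : 'M[R]_n.+1 := 1%:M - u^T *m ((u 0 k)^-1 *: delta_mx 0 k).
pose E0 := [set x - p | x in E].
have bE0 : bnd E0 by exact: bnd_translate.
have [r E0r] := bE0.
pose rk : 'rV[R]_n.+1 := \row_i (if i == k then 0 else r).
suff h : (mu E0 <= 0)%E.
  by apply/eqP; rewrite eq_le leb_ge0 andbT -(leb_translate (- p) bE).
apply: (@le_trans _ _ (mu [set x *m M | x in box (- rk) rk])).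
  apply: leb_le => x xE0; have := E0r _ xE0 => xr.
  have xu : x *m u^T = 0.
    case: xE0 => y yE <-; rewrite mulmxDl mulNmx lp lE (Et _ yE).
    by rewrite subrr.
  exists (x - x 0 k *: delta_mx 0 k).
    move=> i; rewrite !mxE eqxx /=; case: eqP => [->|_] /=.
      by rewrite mulr1 subrr oppr0 lexx.
    by have := xr i; rewrite !mxE mulr0 subr0.
  rewrite mulmxBr mulmx1 mulmxA mulmxBl xu sub0r mulNmx -scalemxAl -rowE.
  rewrite (_ : row k u^T = (u 0 k)%:M); last first.
    by apply/matrixP => i j; rewrite !ord1 !mxE mulr1n.
  by rewrite -scalemxAl mul_scalar_mx (scalerA (u 0 k)) divff // scale1r opprK subrK.
apply: le_trans (leb_mulmx_box_le _ _ _) _.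
by rewrite (@box_vol_eq0 _ _ _ _ k) ?mulr0 // !mxE eqxx oppr0.
Qed.

End LinearImages2.

(** * Outer regularity on compact sets *)

Section Regularity.
Variables (R : realType) (n : nat).
Implicit Types (A E : set 'rV[R]_n.+1) (a b x v : 'rV[R]_n.+1).
Local Notation mu := (@leb R n).

Definition thicken A (e : R) : set 'rV[R]_n.+1 :=
  [set x | exists2 a, A a & forall i, `|x 0 i - a 0 i| <= e].

Lemma compact_bnd A : compact A -> bnd A.
Proof.
move=> /compact_bounded[M [Mreal AM]]; exists (M + 1) => x xA i.
rewrite !mxE -ler_norml; apply: le_trans (AM (M + 1) _ _ xA); last first.
  by rewrite ltrDl.
have /mapP[j Hj ->] : `|x 0 i| \in [seq `|x y.1 y.2| | y : 'I_1 * 'I_n.+1].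
  by apply/mapP; exists (0, i) => //=; rewrite mem_enum.
by rewrite [leRHS]/Num.norm /= mx_normrE; apply/bigmax_geP; right => /=; exists j.
Qed.

Lemma box_vol_enlarge a b (d : R) : 0 < d -> exists2 r, 0 < r &
  box_vol (a - const_mx r) (b + const_mx r) <= box_vol a b + d.
Proof.
move=> d0; pose w i := Num.max (b 0 i - a 0 i) 0.
have w0 i : 0 <= w i by rewrite le_max lexx orbT.
set C := \prod_i (w i + 2).
have C0 : 0 <= C by apply: prodr_ge0 => i _; rewrite addr_ge0.
have C1 : 0 < C + 1 by rewrite ltr_wpDl.
pose s := Num.min 1 (d / (C + 1)).
have s0 : 0 < s by rewrite lt_min ltr01 divr_gt0.
have s1 : s <= 1 by rewrite ge_min lexx.
exists (s / 2); first by rewrite divr_gt0.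
apply: (@le_trans _ _ (\prod_i (w i + s))).
  apply: ler_prod => i _; rewrite !mxE le_max lexx orbT /=.
  have h : b 0 i - a 0 i <= w i by rewrite le_max lexx.
  by rewrite ge_max addr_ge0 ?(ltW s0) // andbT; lra.
apply: (@le_trans _ _ (\prod_i w i + s * C)).
  by apply: prod_addr_le => //; rewrite (ltW s0).
rewrite lerD2l.
have h : s * (C + 1) <= d by rewrite -ler_pdivlMr // ge_min lexx orbT.
by apply: le_trans h; rewrite ler_wpM2l ?(ltW s0) // lerDl.
Qed.

(** The boxes of a nearly optimal cover are enlarged at summable cost. By compactness a single
    radius, a Lebesgue number of the enlarged cover, works at every point of [A]. *)
Lemma leb_outer_regular A (d : R) : compact A -> 0 < d ->
  exists2 e : R, 0 < e & (mu (thicken A e) <= mu A + d%:E)%E.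
Proof.
move=> cA d0; have d2 : 0 < d / 2 by rewrite divr_gt0.
have [ab cov le] := leb_cover_adherent d2 (leb_bnd_fin (compact_bnd cA)).
have dk k : 0 < d / 2 / (2 ^ k.+1)%:R by rewrite divr_gt0 // ltr0n expn_gt0.
have /choice[r Pr] : forall k, exists r : R, 0 < r /\
    box_vol ((ab k).1 - const_mx r) ((ab k).2 + const_mx r) <=
    box_vol (ab k).1 (ab k).2 + d / 2 / (2 ^ k.+1)%:R.
  by move=> k; have [r ? ?] := box_vol_enlarge (ab k).1 (ab k).2 (dk k); exists r.
pose B k := box ((ab k).1 - const_mx (r k)) ((ab k).2 + const_mx (r k)).
have [e e0 Ae] : exists2 e : R, 0 < e & A `<=` [set x | exists k, forall x',
    (forall i, `|x' 0 i - x 0 i| <= e) -> B k x'].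
  have := (compact_near_coveringP A).1 cA R (0^'+)
    (fun e x => exists k, forall x' : 'rV[R]_n.+1,
      (forall i, `|x' 0 i - x 0 i| <= e) -> B k x') _.
  move=> H.
  have : \forall e \near 0^'+, A `<=` [set x | exists k, forall x' : 'rV[R]_n.+1,
      (forall i, `|x' 0 i - x 0 i| <= e) -> B k x'].
    apply: H => x /cov[k _ xk].
    have r0 := (Pr k).1; have r2 : 0 < r k / 2 by rewrite divr_gt0.
    (* Half of the margin [r k] pays for moving from [x] to [y], the other half for moving from [y]
       to [x']. *)
    exists (ball x (r k / 2), [set e : R | 0 < e < r k / 2]).
      split; first exact: nbhsx_ballx.
      near=> e; apply/andP; split; near: e; first exact: nbhs_right_gt.
      exact: nbhs_right_lt.
    move=> [y e] [/= [_ xy] /andP[e0 e1]]; exists k => x' hx' i.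
    have := xy 0 i; rewrite /ball /= ltr_norml => /andP[h1 h2].
    have := hx' i; rewrite ler_norml => /andP[h3 h4].
    have /andP[h5 h6] := xk i.
    by rewrite !mxE; apply/andP; split; lra.
  move=> near_e.
  have /filter_ex[e [He e0]] : \forall e \near (0 : R)^'+,
      (A `<=` [set x | exists k, forall x' : 'rV[R]_n.+1,
      (forall i, `|x' 0 i - x 0 i| <= e) -> B k x']) /\ 0 < e.
    by near=> e; split; near: e => //; exact: nbhs_right_gt.
  by exists e.
exists e => //.
apply: (@le_trans _ _ (\sum_(0 <= k <oo) (box_vol (ab k).1 (ab k).2 +
    d / 2 / (2 ^ k.+1)%:R)%:E)%E).
  apply: (@le_trans _ _ (\sum_(0 <= k <oo) (box_vol ((ab k).1 - const_mx (r k))%R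
      ((ab k).2 + const_mx (r k))%R)%:E)%E).
    apply: (@leb_le_cover _ _ _ (fun k => ((ab k).1 - const_mx (r k),
      (ab k).2 + const_mx (r k)))) => x [a /Ae[k Bk] /Bk xk].
    by exists k.
  apply: lee_nneseries => k _ => [_|]; first by rewrite lee_fin box_vol_ge0.
  by rewrite lee_fin (Pr k).2.
under eq_eseriesr do rewrite EFinD.
apply: le_trans (epsilon_trick _ _ (ltW d2)) _.
  by move=> k; rewrite lee_fin box_vol_ge0.
apply: le_trans (leeD2r _ le) _.
by rewrite -addeA -EFinD -splitr.
Unshelve. all: by end_near. Qed.

End Regularity.

(** * Linear programming *)

Section LinearProgram.
Variables (R : realFieldType) (N d : nat) (A : 'M[R]_(N, d)) (c : 'cV[R]_N).
Implicit Types (B : {set 'I_N}) (q : 'rV[R]_d) (y z : 'rV[R]_N) (u : 'cV[R]_d).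

(** [selmx B *m A] keeps the rows of [A] in [B], while [w *m selmx B] spreads [w] over [B] and pads
    with 0. *)
Definition selmx B : 'M[R]_(#|B|, N) := rowsub enum_val 1%:M.

Definition supp y : {set 'I_N} := finset (fun t => y 0 t != 0).

Definition supported y B := forall t, t \notin B -> y 0 t = 0.

Definition indep B := row_free (selmx B *m A).

Definition feasible q y := (forall t, 0 <= y 0 t) /\ y *m A = q.

Definition cost y : R := (y *m c) 0 0.

(** [u] is a dual feasible vector whose tight constraints are exactly those of [B]; geometrically,
    [B] is a cell of the regular subdivision induced by the heights [c]. *)
Definition lower_cell B := exists u, (forall t, t \in B -> c t 0 = (A *m u) t 0) /\
  (forall t, t \notin B -> (A *m u) t 0 < c t 0).

Definition in_cell q B := exists y, [/\ y *m A = q, supported y B &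
  forall t, t \in B -> 0 < y 0 t].

Lemma mul_selmx B (w : 'rV[R]_#|B|) k : (w *m selmx B) 0 (enum_val k) = w 0 k.
Proof.
rewrite mxE (bigD1 k) //= big1 => [|j jk]; rewrite !mxE ?eqxx ?mulr1 ?addr0 //.
by rewrite (inj_eq enum_val_inj) (negbTE jk) mulr0.
Qed.

Lemma supported_selmx B (w : 'rV[R]_#|B|) : supported (w *m selmx B) B.
Proof.
move=> t tB; rewrite mxE big1 // => j _; rewrite !mxE.
case: eqP => [ejt|_]; last by rewrite mulr0.
by rewrite -ejt enum_valP in tB.
Qed.

Lemma supported_selmxE B y : supported y B ->
  y = (\row_k y 0 (enum_val k)) *m selmx B.
Proof.
move=> yB; apply/rowP => t; have [tB|tB] := boolP (t \in B); last first.
  by rewrite yB // supported_selmx.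
by rewrite -(enum_rankK_in tB tB) mul_selmx mxE.
Qed.

Lemma indepP B : reflect
  (forall z, supported z B -> z *m A = 0 -> z = 0) (indep B).
Proof.
apply: (iffP idP) => [fB z zB zA|h].
  rewrite (supported_selmxE zB) -mulmxA in zA.
  rewrite (supported_selmxE zB) (_ : \row__ _ = 0) ?mul0mx //.
  by apply: (row_free_inj fB); rewrite zA mul0mx.
apply: inj_row_free => w; rewrite mulmxA => wA.
have /rowP w0 := h _ (@supported_selmx _ w) wA.
by apply/rowP => k; rewrite -mul_selmx w0 !mxE.
Qed.

Lemma indepPn B : ~~ indep B ->
  exists z, [/\ supported z B, z *m A = 0 & z != 0].
Proof.
move=> nB; apply: contrapT => h; move/negP: nB; apply; apply/indepP => z zB zA.
by apply: contrapT => /eqP z0; apply: h; exists z.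
Qed.

Lemma costD y z : cost (y + z) = cost y + cost z.
Proof. by rewrite /cost mulmxDl mxE. Qed.

Lemma costZ (s : R) y : cost (s *: y) = s * cost y.
Proof. by rewrite /cost -scalemxAl mxE. Qed.

Lemma costE_dual q y u : y *m A = q ->
  cost y = (q *m u) 0 0 + \sum_t y 0 t * (c t 0 - (A *m u) t 0).
Proof.
move=> <-; rewrite /cost -mulmxA !mxE -big_split /=; apply: eq_bigr => t _.
by rewrite mulrBr addrC subrK.
Qed.

(* Weak duality: the cost of any feasible point is at least the value [q *m u] attained on the
   cell of [B], with equality only if the support lies in [B]. *)
Lemma lower_cell_sub q B B' : lower_cell B -> lower_cell B' ->
  in_cell q B -> in_cell q B' -> B' \subset B.
Proof.
move=> [u [uB uNB]] [u' [uB' uNB']] [y [yq sy yB]] [y' [yq' sy' yB']].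
have ge0 (D : {set 'I_N}) (w : 'cV[R]_d) (z : 'rV[R]_N) :
    (forall t, t \in D -> c t 0 = (A *m w) t 0) ->
    (forall t, t \notin D -> (A *m w) t 0 < c t 0) ->
    (forall t, 0 <= z 0 t) -> forall t, 0 <= z 0 t * (c t 0 - (A *m w) t 0).
  move=> h1 h2 z0 t; rewrite mulr_ge0 // subr_ge0.
  by have [/h1 ->|/h2/ltW] := boolP (t \in D).
have y0 t : 0 <= y 0 t by have [/yB/ltW|/sy ->] := boolP (t \in B).
have y'0 t : 0 <= y' 0 t by have [/yB'/ltW|/sy' ->] := boolP (t \in B').
have eq0 (D : {set 'I_N}) (w : 'cV[R]_d) (z : 'rV[R]_N) :
    (forall t, t \in D -> c t 0 = (A *m w) t 0) ->
    supported z D -> \sum_t z 0 t * (c t 0 - (A *m w) t 0) = 0.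
  move=> h1 h2; apply: big1 => t _.
  by have [/h1 ->|/h2 ->] := boolP (t \in D); rewrite ?subrr ?mulr0 ?mul0r.
have e1 := costE_dual u yq; rewrite (eq0 _ _ _ uB sy) addr0 in e1.
have e2 := costE_dual u' yq'; rewrite (eq0 _ _ _ uB' sy') addr0 in e2.
have e3 := costE_dual u yq'; have e4 := costE_dual u' yq.
have S1 : 0 <= \sum_t y 0 t * (c t 0 - (A *m u') t 0).
  by apply: sumr_ge0 => t _; exact: (ge0 B').
have S2 : 0 <= \sum_t y' 0 t * (c t 0 - (A *m u) t 0).
  by apply: sumr_ge0 => t _; exact: (ge0 B).
have /eqP : \sum_t y' 0 t * (c t 0 - (A *m u) t 0) = 0 by lra.
rewrite psumr_eq0 => [/allP h|t _]; last exact: (ge0 B).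
apply/fintype.subsetP => t tB'; apply: contraT => tB.
have := h t (mem_index_enum _); rewrite mulf_eq0 subr_eq0.
by rewrite (gt_eqF (yB' t tB')) gt_eqF ?uNB.
Qed.

Hypothesis kernel_sum0 : forall z, z *m A = 0 -> \sum_t z 0 t = 0.

(** While the support is dependent, move along a kernel vector of nonpositive cost until a weight
    vanishes. By [kernel_sum0] a nonzero kernel vector has a negative entry, so the move does
    stop. *)
Lemma indep_reduction q y : feasible q y ->
  exists2 y', feasible q y' &
    cost y' <= cost y /\ indep (supp y').
Proof.
have [m] := ubnP #|supp y|; elim: m y => // m IH y /ltnSE le fy.
have [ind|/indepPn[z0 [z0B z0A z0n]]] := boolP (indep (supp y)).
  by exists y.
have [z [zB zA zn zc]] : exists z, [/\ supported z (supp y),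
    z *m A = 0, z != 0 & cost z <= 0].
  have [c0|c0] := leP (cost z0) 0; first by exists z0.
  exists (- z0); split; rewrite ?oppr_eq0 // ?mulNmx ?z0A ?oppr0 //.
    by move=> t tB; rewrite mxE z0B ?oppr0.
  by rewrite -scaleN1r costZ mulN1r oppr_le0 ltW.
have [t0 t0n] : exists t, z 0 t < 0.
  apply: contrapT => h; move/eqP: zn; apply; apply/rowP => t; rewrite mxE.
  have zp s : true -> 0 <= z 0 s.
    by move=> _; rewrite leNgt; apply/negP => hs; apply: h; exists s.
  have /eqP := kernel_sum0 zA; rewrite psumr_eq0 // => /allP/(_ t).
  by rewrite mem_index_enum => /(_ isT)/eqP.
(* Ratio test: [t] is a coordinate that reaches 0 first, so the step [s] keeps every weight
   nonnegative. *)
have [t tn tmin] := @Order.TotalTheory.arg_minP _ _ _ t0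
  (fun t => z 0 t < 0) (fun t => y 0 t / - z 0 t) t0n.
pose s := y 0 t / - z 0 t; have [y0 yA] := fy.
have s0 : 0 <= s by rewrite divr_ge0 // oppr_ge0 ltW.
have [||y' fy' [cy' iy']] := IH (y + s *: z).
- apply: leq_trans le; apply: proper_card; apply/properP; split.
    apply/fintype.subsetP => j; rewrite !inE !mxE; apply: contraNneq => yj.
    by rewrite zB ?inE ?yj ?eqxx // mulr0 addr0.
  exists t; rewrite !inE.
    apply/eqP => yt; have := zB t; rewrite inE yt eqxx => /(_ isT) zt.
    by rewrite zt ltxx in tn.
  rewrite !mxE negbK /s invrN mulrN mulNr divfK ?subrr //.
  by rewrite lt_eqF.
- split; last by rewrite mulmxDl -scalemxAl zA scaler0 addr0.
  move=> j; rewrite !mxE; have [zj|zj] := leP 0 (z 0 j).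
    by rewrite addr_ge0 // mulr_ge0.
  have := tmin j zj; rewrite -/s ler_pdivlMr ?oppr_gt0 //.
  by rewrite mulrN; lra.
exists y' => //; split => //; apply: le_trans cy' _.
rewrite costD costZ; have : s * cost z <= 0 by rewrite mulr_ge0_le0.
lra.
Qed.

Hypothesis generic : forall B u, (forall t, t \in B -> c t 0 = (A *m u) t 0) ->
  indep B.

(** A cheapest basic feasible point is optimal. The nondegeneracy hypothesis forces its support to
    have size [d], so it determines a dual vector [u]; optimality makes the reduced costs
    nonnegative, and genericity makes them nonzero off the support. *)
Lemma lower_cell_exists q y : feasible q y ->
  (forall B z, (#|B| < d)%N -> supported z B -> z *m A != q) ->
  exists B, [/\ lower_cell B, in_cell q B & #|B| = d].
Proof.
move=> fy nd.
pose P (B : {set 'I_N}) := `[< exists z, [/\ feasible q z, supp z = B & indep B] >].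
(* An independent support carries only one feasible point, so minimising over the finitely many
   supports minimises over all basic points. *)
pose w (B : {set 'I_N}) := xget 0 [set z | feasible q z /\ supp z = B].
have wP B : P B -> feasible q (w B) /\ supp (w B) = B.
  move=> /asboolP[z [fz Sz _]]; rewrite /w; case: xgetP => [x -> //|].
  by move=> /(_ z) h; case: h.
have [y1 fy1 [_ iy1]] := indep_reduction fy.
have PB1 : P (supp y1) by apply/asboolP; exists y1.
have [B PB Bmin] := @Order.TotalTheory.arg_minP _ _ _ (supp y1) P (fun B => cost (w B)) PB1.
have [fz Sz] := wP _ PB; set z := w B in fz Sz Bmin.
have iB : indep B by move/asboolP: PB => [? []].
have zB : supported z B by move=> t; rewrite -Sz inE negbK => /eqP.
have opt z' : feasible q z' -> cost z <= cost z'.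
  move=> /indep_reduction[z2 fz2 [le2 ind2]].
  have PB2 : P (supp z2) by apply/asboolP; exists z2.
  apply: le_trans le2; apply: le_trans (Bmin _ PB2) _.
  have [fw Sw] := wP _ PB2.
  suff -> : w (supp z2) = z2 by [].
  apply/eqP; rewrite -subr_eq0; apply/eqP; move/indepP: (ind2); apply.
    move=> t; rewrite inE negbK => /eqP z2t.
    have : t \notin supp (w (supp z2)) by rewrite Sw inE z2t eqxx.
    by rewrite inE negbK !mxE z2t => /eqP ->; rewrite subrr.
  by rewrite mulmxBl fw.2 fz2.2 subrr.
have rB : \rank (selmx B *m A) = #|B| by apply/eqP.
have cB : #|B| = d.
  apply/eqP; rewrite eqn_leq -{1}rB rank_leq_col /= leqNgt.
  by apply/negP => /nd /(_ zB); rewrite fz.2 eqxx.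
pose u := pinvmx (selmx B *m A) *m (selmx B *m c).
have uE : selmx B *m (A *m u) = selmx B *m c.
  by rewrite mulmxA mulmxA mulmxVp // mul1mx.
have uB t : t \in B -> c t 0 = (A *m u) t 0.
  move=> tB; have selE (m : 'cV[R]_N) : (selmx B *m m) (enum_rank_in tB t) 0 = m t 0.
    by rewrite mul_rowsub_mx mul1mx mxE enum_rankK_in.
  by rewrite -[LHS]selE -uE selE.
have z0 t : t \in B -> 0 < z 0 t.
  by rewrite -{1}Sz inE => h; rewrite lt_neqAle eq_sym h fz.1.
exists B; split => //; last first.
  by exists z; split; [exact: fz.2 | exact: zB | exact: z0].
exists u; split => // t tB.
have fullB : row_full (selmx B *m A) by rewrite /row_full rB cB.
have /submxP[v vE] := submx_full (row t A) fullB.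
(* The edge direction that raises the weight of [t] by 1 and compensates inside [B]; its cost is the
   reduced cost of [t]. *)
pose k := delta_mx 0 t - v *m selmx B.
have kA : k *m A = 0 by rewrite mulmxBl -rowE vE mulmxA subrr.
have kE j : j \notin B -> k 0 j = (j == t)%:R.
  move=> jB; rewrite /k mxE [(- (v *m _)) _ _]mxE supported_selmx // subr0 mxE.
  by rewrite eqxx.
have kt : k 0 t = 1 by rewrite kE // eqxx.
have ck : cost k = c t 0 - (A *m u) t 0.
  have := costE_dual u kA; rewrite mul0mx mxE add0r => ->.
  rewrite (bigD1 t) //= kt mul1r big1 ?addr0 // => j jt.
  have [/uB ->|jB] := boolP (j \in B); first by rewrite subrr mulr0.
  by rewrite kE // (negbTE jt) mul0r.
have rc0 : 0 <= c t 0 - (A *m u) t 0.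
  (* A step short enough to stay feasible. The added 1 keeps denominators positive, and the default
     1 covers an empty [B]. *)
  pose s := \big[Num.min/1]_(j in B) (z 0 j / (`|k 0 j| + 1)).
  have s0 : 0 < s.
    rewrite /s; elim/big_ind: _ => // [x x' x0 x'0|j jB]; first by rewrite lt_min x0.
    by rewrite divr_gt0 ?z0 // ltr_wpDl.
  have fs : feasible q (z + s *: k).
    split; last by rewrite mulmxDl -scalemxAl kA scaler0 addr0 fz.2.
    move=> j; rewrite mxE [(s *: k) 0 j]mxE.
    have [jB|jB] := boolP (j \in B); last first.
      rewrite zB // add0r mulr_ge0 ?(ltW s0) //.
      by rewrite kE // ler0n.
    have : s <= z 0 j / (`|k 0 j| + 1) by rewrite /s (bigD1 j) //= ge_min lexx.
    rewrite ler_pdivlMr ?ltr_wpDl // mulrDr mulr1.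
    have : - (s * `|k 0 j|) <= s * k 0 j.
      by rewrite -mulrN ler_wpM2l ?(ltW s0) // lerNl -normrN ler_norm.
    by have := s0; lra.
  by have := opt _ fs; rewrite costD costZ lerDl pmulr_rge0 // ck.
(* If the reduced cost were 0, [u] would match the costs on [t |: B], making that set independent
   although [k] is a nonzero kernel vector on it. *)
rewrite lt_neqAle -subr_ge0 rc0 andbT; apply/eqP => rc.
have /indepP/(_ k) : indep (t |: B).
  by apply: (generic (u := u)) => j; rewrite !inE => /predU1P[->//|/uB].
move=> /(_ _ kA) h; have {}h : k = 0.
  apply: h => j; rewrite !inE negb_or => /andP[jt jB].
  by rewrite kE // (negbTE jt).
by have := kt; rewrite h mxE => /eqP; rewrite eq_sym oner_eq0.
Qed.

End LinearProgram.

Lemma poly_nonroot (R : numDomainType) (p : {poly R}) : p != 0 ->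
  exists x : R, p.[x] != 0.
Proof.
move=> p0; apply: contrapT => h.
have ar : all (root p) [seq i%:R | i <- iota 0 (size p)].
  apply/allP => x _; rewrite /root; apply/negPn/negP => px; apply: h.
  by exists x.
have := max_poly_roots p0 ar; rewrite size_map size_iota ltnn.
rewrite map_inj_uniq ?iota_uniq; first by move=> /(_ isT).
by apply: mulrIn; exact: oner_neq0.
Qed.

(** Costs are taken on the moment curve [x ^+ t]. A dependent [B] has a kernel vector [z B], and
    costs of the form [A *m u] on [B] would make [x] a root of the nonzero polynomial with
    coefficients [z B]. It suffices to avoid the roots of finitely many polynomials. *)
Lemma generic_cost (R : realFieldType) (N d : nat) (A : 'M[R]_(N, d)) :
  exists c : 'cV[R]_N, forall (B : {set 'I_N}) (u : 'cV[R]_d),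
    (forall t, t \in B -> c t 0 = (A *m u) t 0) -> indep A B.
Proof.
pose z B := xget 0 [set z : 'rV[R]_N |
  [/\ supported z B, z *m A = 0 & z != 0]].
have zP B : ~~ indep A B -> [/\ supported (z B) B, z B *m A = 0 & z B != 0].
  move=> /indepPn[x xP]; rewrite /z; case: xgetP => [y -> //|/(_ x) h].
  by case: h.
pose pz B : {poly R} := \poly_(t < N) (if insub t is Some i then z B 0 i else 0).
have /poly_nonroot[x] : \prod_(B | ~~ indep A B) pz B != 0.
  apply/prodf_neq0 => B /zP[_ _]; apply: contraNneq => pB.
  apply/eqP/rowP => i; have := coef_poly N (fun t => if insub t is Some i then z B 0 i else 0) i.
  by rewrite -/(pz B) pB coef0 ltn_ord valK mxE.
rewrite horner_prod => /prodf_neq0 h.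
exists (\col_t x ^+ t) => B u cu; apply/negPn/negP => nB.
have [zB zA _] := zP B nB; have /eqP := h B nB; apply.
rewrite horner_poly.
transitivity ((z B *m (A *m u)) 0 0); last by rewrite mulmxA zA mul0mx mxE.
rewrite mxE; apply: eq_bigr => t _; rewrite valK.
have [tB|tB] := boolP (t \in B); last by rewrite zB // !mul0r.
by rewrite -cu // mxE.
Qed.

(** * Volume of sums of polytopes *)

Lemma caratheodory_polyhedron (R : realType) (n : nat) (J : finType)
    (U : J -> 'rV[R]_n.+1) (b : J -> R) :
  (@leb R n).-caratheodory [set x | forall j, b j < lform (U j) x].
Proof.
suff H (s : seq J) : (@leb R n).-caratheodory
    [set x | forall j, j \in s -> b j < lform (U j) x].
  have := H (enum J); congr (caratheodory_measurable _ _).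
  by apply/seteqP; split => x /= h j => [|_]; apply: h; rewrite mem_enum.
elim: s => [|j s IH].
  rewrite (_ : [set x | _] = ~` set0); last by rewrite setC0; apply/seteqP.
  exact/caratheodory_measurable_setC/caratheodory_measurable_set0.
have := caratheodory_measurable_setI (caratheodory_lform_gt (U j) (b j)) IH.
congr (caratheodory_measurable _ _); apply/seteqP; split => x /=.
  by move=> [h1 h2] k; rewrite inE => /predU1P[->//|/h2].
by move=> h; split => [|k ks]; apply: h; rewrite inE ?eqxx // ks orbT.
Qed.

Lemma leb_disjoint_le (R : realType) (n : nat) (I : finType) (P : pred I)
    (F : I -> set 'rV[R]_n.+1) (A : set 'rV[R]_n.+1) :
  (forall i, P i -> (@leb R n).-caratheodory (F i)) ->
  (forall i, P i -> F i `<=` A) ->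
  (forall i j x, P i -> P j -> F i x -> F j x -> i = j) ->
  (\sum_(i | P i) leb (F i) <= leb A)%E.
Proof.
move=> mF FA tF.
suff H (r : seq I) E : uniq r -> (forall i, i \in r -> P i -> F i `<=` E) ->
    (\sum_(i <- r | P i) leb (F i) <= leb E)%E.
  by apply: H; rewrite ?index_enum_uniq // => i _; exact: FA.
elim: r E => [|i r IH] E /=; first by rewrite big_nil leb_ge0.
move=> /andP[ir ur] FE; rewrite big_cons; case: ifPn => Pi; last first.
  by apply: IH => // j jr; apply: FE; rewrite inE jr orbT.
rewrite [leRHS](mF i Pi E); apply: leeD.
  by apply: leb_le => x Fx; split => //; apply: FE Fx; rewrite // inE eqxx.
apply: IH => // j jr Pj x Fx; split; first by apply: FE Fx; rewrite // inE jr orbT.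
by move=> Fix; move: ir; rewrite (tF i j x) // jr.
Qed.

(** * Cells of the Cayley configuration and their volumes *)

Section Cells.
Variables (R : realType) (n r N : nat) (V : 'M[R]_(N, n.+1)) (g : 'I_N -> 'I_r).
Implicit Types (B : {set 'I_N}) (lam : 'rV[R]_r) (p w : 'rV[R]_n.+1) (y : 'rV[R]_N).
Local Notation mu := (@leb R n).

Definition groupmx : 'M[R]_(N, r) := \matrix_t delta_mx 0 (g t).

Definition cayley : 'M[R]_(N, n.+1 + r) := row_mx V groupmx.

Definition polytope_sum lam : set 'rV[R]_n.+1 :=
  [set p | exists y, feasible cayley (row_mx p lam) y].

Definition open_cell lam B : set 'rV[R]_n.+1 :=
  [set p | in_cell cayley (row_mx p lam) B].

Lemma mul_groupmx y i : (y *m groupmx) 0 i = \sum_t (g t == i)%:R * y 0 t.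
Proof.
by rewrite mxE; apply: eq_bigr => t _; rewrite !mxE eqxx /= eq_sym mulrC.
Qed.

Lemma groupmx_mul (eta : 'cV[R]_r) t : (groupmx *m eta) t 0 = eta (g t) 0.
Proof.
rewrite mxE (bigD1 (g t)) //= !mxE !eqxx mul1r big1 ?addr0 // => k kg.
by rewrite !mxE (negbTE kg) andbF mul0r.
Qed.

Lemma mul_cayley y p lam : y *m cayley = row_mx p lam <->
  y *m V = p /\ y *m groupmx = lam.
Proof. by rewrite mul_mx_row; split => [/eq_row_mx[]|[-> ->]]. Qed.

Lemma cayley_kernel_sum0 y : y *m cayley = 0 -> \sum_t y 0 t = 0.
Proof.
rewrite -row_mx0 => /mul_cayley[_ y0].
transitivity (\sum_i (y *m groupmx) 0 i); last first.
  by rewrite y0; apply: big1 => i _; rewrite mxE.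
under [RHS]eq_bigr do rewrite mul_groupmx.
rewrite exchange_big; apply: eq_bigr => t _; rewrite (bigD1 (g t)) //= eqxx mul1r.
by rewrite big1 ?addr0 // => i; rewrite eq_sym => /negbTE ->; rewrite mul0r.
Qed.

Lemma bnd_polytope_sum lam : bnd (polytope_sum lam).
Proof.
exists (\sum_j \sum_t lam 0 (g t) * `|V t j|) => p [y [y0 /mul_cayley[yV yG]]] j.
have yl t : y 0 t <= lam 0 (g t).
  rewrite -yG mul_groupmx (bigD1 t) //= eqxx mul1r lerDl.
  by apply: sumr_ge0 => s _; rewrite mulr_ge0.
rewrite !mxE -ler_norml -yV mxE; apply: le_trans (ler_norm_sum _ _ _) _.
apply: (@le_trans _ _ (\sum_t lam 0 (g t) * `|V t j|)).
  by apply: ler_sum => t _; rewrite normrM ger0_norm // ler_wpM2r.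
rewrite [leRHS](bigD1 j) //= lerDl; apply: sumr_ge0 => k _.
by apply: sumr_ge0 => t _; rewrite mulr_ge0 // (le_trans (y0 t)).
Qed.

(** Too few rows leave a nonzero column [col_mx xi eta] that annihilates all of them. If [xi] is
    nonzero, it confines [p] to a hyperplane. Otherwise some [eta i] is nonzero, so [B] contains no
    vertex of group [i], which contradicts a positive total weight [lam 0 i]. *)
Lemma degenerate_null lam B : (forall i, 0 < lam 0 i) -> (#|B| < n.+1 + r)%N ->
  mu (polytope_sum lam `&` [set p | exists2 z, supported z B &
    z *m cayley = row_mx p lam]) = 0%E.
Proof.
move=> lam0 cB; set W := polytope_sum lam `&` _.
have bW : bnd W by have [b Pb] := bnd_polytope_sum lam; exists b => p [/Pb].
pose C := cokermx (selmx R B *m cayley).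
have [i0 [j0 Cij]] : exists i j, C i j != 0.
  apply/matrix0Pn; rewrite -mxrank_eq0 mxrank_coker subn_eq0 -ltnNge.
  exact: leq_ltn_trans (rank_leq_row _) cB.
pose w := col j0 C.
have wn : w != 0 by apply/matrix0Pn; exists i0, 0; rewrite mxE.
have Bw : selmx R B *m cayley *m w = 0.
  by rewrite /w colE mulmxA mulmx_coker mul0mx.
have zw z : supported z B -> z *m cayley *m w = 0.
  by move=> /supported_selmxE ->; rewrite -!mulmxA [selmx R B *m _]mulmxA Bw mulmx0.
pose xi := usubmx w; pose eta := dsubmx w.
have wE : w = col_mx xi eta by rewrite vsubmxK.
have [xi0|xi0] := eqVneq xi 0; last first.
  apply: (@leb_hyperplane _ _ xi^T (- (lam *m eta) 0 0) W).
  - by rewrite trmx_eq0.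
  - exact: bW.
  move=> p [_ [z zB zA]].
  have := zw z zB; rewrite zA wE mul_row_col => /eqP; rewrite addr_eq0 => /eqP h.
  transitivity ((p *m xi) 0 0); last by rewrite h mxE.
  by rewrite mxE; apply: eq_bigr => k _; rewrite mxE.
have [i [j etai]] : exists i j, eta i j != 0.
  apply/matrix0Pn; apply: contra wn => /eqP e0.
  by rewrite wE xi0 e0 col_mx0.
rewrite ord1 in etai.
rewrite (_ : W = set0) ?leb0 //; apply/seteqP; split => // p [_ [z zB zA]].
have [_ zG] := (mul_cayley z p lam).1 zA.
have := lam0 i; rewrite -zG mul_groupmx big1 ?ltxx // => t _.
case: eqP => [gt|_]; last by rewrite mul0r.
have [tB|tB] := boolP (t \in B); last by rewrite zB // mulr0.
have cw : cayley *m w = groupmx *m eta.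
  by rewrite wE xi0 mul_row_col mulmx0 add0r.
have st : supported (delta_mx 0 t : 'rV[R]_N) B.
  move=> s sB; rewrite mxE eqxx /=; case: eqP => // st.
  by rewrite st tB in sB.
have := zw _ st; rewrite -mulmxA cw -rowE => /matrixP/(_ 0 0).
by rewrite mxE groupmx_mul gt => h; rewrite h mxE eqxx in etai.
Qed.

Section OneCell.
Variable B : {set 'I_N}.
Hypotheses (iB : indep cayley B) (cB : #|B| = (n.+1 + r)%N).

(** The rows of [B] have full column rank; if [B] missed group [i], they would all be annihilated by
    the column selecting the weight of that group. *)
Lemma cell_section : exists s : 'I_r -> 'I_N, forall i, s i \in B /\ g (s i) = i.
Proof.
suff /choice[s sP] : forall i, exists t, t \in B /\ g t = i by exists s.
move=> i; apply: contrapT => h.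
have /row_fullP[L LB] : row_full (selmx R B *m cayley).
  by rewrite /row_full (eqP (iB : _ == _)) cB.
pose w : 'cV[R]_(n.+1 + r) := col_mx 0 (delta_mx i 0).
have Bw : selmx R B *m cayley *m w = 0.
  apply/matrixP => k j; rewrite ord1 -mulmxA mul_row_col mulmx0 add0r.
  rewrite mul_rowsub_mx mul1mx mxE groupmx_mul !mxE eqxx andbT.
  case: eqP => // gi.
  by case: h; exists (enum_val k); rewrite enum_valP.
have : w = 0 by rewrite -[w]mul1mx -LB -mulmxA Bw mulmx0.
move/matrixP/(_ (rshift _ i) 0); rewrite col_mxEd !mxE !eqxx => /eqP.
by rewrite oner_eq0.
Qed.

(** One vertex [s i] of each group becomes the base point of the simplex of that group; the [n.+1]
    remaining vertices [e j] provide the coordinates. *)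
Lemma cell_enum : exists (s : 'I_r -> 'I_N) (e : 'I_n.+1 -> 'I_N),
  let h x := match x with inl j => e j | inr i => s i end in
  [/\ forall i, g (s i) = i, injective h & B = [set h x | x : 'I_n.+1 + 'I_r]%SET].
Proof.
have [s sP] := cell_section; exists s.
have sI : injective s by move=> i j /(congr1 g); rewrite (sP i).2 (sP j).2.
pose S := (s @: finset.setT)%SET.
have SB : S \subset B by apply/fintype.subsetP => _ /imsetP[i _ ->]; exact: (sP i).1.
have cS : #|S| = r by rewrite card_imset // cardsT card_ord.
have cE : #|B :\: S| = n.+1.
  by rewrite cardsD (finset.setIidPr SB) cS cB addnK.
pose e (j : 'I_n.+1) : 'I_N := enum_val (cast_ord (esym cE) j).
exists e => h.
have eP j : e j \in B :\: S by exact: enum_valP.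
have hI : injective h.
  move=> [j|i] [j'|i'] /= => [/enum_val_inj/cast_ord_inj -> //|eq|eq|/sI -> //].
    by have := eP j; rewrite eq inE /S imset_f.
  by have := eP j'; rewrite -eq inE /S imset_f.
split=> // [i|]; first exact: (sP i).2.
apply/esym/eqP; rewrite eqEcard; apply/andP; split.
  apply/fintype.subsetP => _ /imsetP[[j|i] _ ->] /=; last exact: (sP i).1.
  by have := eP j; rewrite inE => /andP[].
by rewrite card_imset // card_sum !card_ord cB.
Qed.

End OneCell.

Section Frame.
Variables (B : {set 'I_N}) (s : 'I_r -> 'I_N) (e : 'I_n.+1 -> 'I_N).
Let h x := match x with inl j => e j | inr i => s i end.
Hypotheses (gs : forall i, g (s i) = i) (hI : injective h).
Hypothesis (hB : B = [set h x | x : 'I_n.+1 + 'I_r]%SET).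

Lemma sum_supported (U : zmodType) (F : 'I_N -> U) :
  (forall t, t \notin B -> F t = 0) ->
  \sum_t F t = \sum_j F (e j) + \sum_i F (s i).
Proof.
move=> F0; rewrite (bigID (mem B)) /= [X in _ + X]big1 // addr0 hB.
by rewrite big_imset /= ?big_sumType //; exact: in2W.
Qed.

Lemma frame_lift (c : 'I_n.+1 + 'I_r -> R) :
  exists2 y, supported y B & forall x, y 0 (h x) = c x.
Proof.
exists (\row_t \sum_x c x * (h x == t)%:R) => [t|x]; rewrite mxE.
  rewrite hB => tB; apply: big1 => x _; case: eqP => [ht|]; last by rewrite mulr0.
  by case/negP: tB; rewrite -ht imset_f.
rewrite (bigD1 x) //= eqxx mulr1 big1 ?addr0 // => x' xx'.
by rewrite (inj_eq hI) (negbTE xx') mulr0.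
Qed.

Definition frame_mx : 'M[R]_n.+1 :=
  \matrix_j (row (e j) V - row (s (g (e j))) V).

Definition frame_org lam : 'rV[R]_n.+1 := \sum_i lam 0 i *: row (s i) V.

Lemma frame_group y i : supported y B ->
  (y *m groupmx) 0 i = \sum_(j | g (e j) == i) y 0 (e j) + y 0 (s i).
Proof.
move=> yB; rewrite mul_groupmx sum_supported => [|t tB]; last first.
  by rewrite yB ?mulr0.
congr (_ + _).
  by rewrite [RHS]big_mkcond; apply: eq_bigr => j _; case: eqP; rewrite ?mul1r ?mul0r.
rewrite (bigD1 i) //= gs eqxx mul1r big1 ?addr0 // => k ki.
by rewrite gs (negbTE ki) mul0r.
Qed.

Lemma frame_point y : supported y B ->
  y *m V = (\row_j y 0 (e j)) *m frame_mx + frame_org (y *m groupmx).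
Proof.
move=> yB; rewrite (mulmx_sum_row y V) (mulmx_sum_row _ frame_mx).
rewrite sum_supported => [|t tB]; last first.
  by rewrite yB ?scale0r.
rewrite /frame_org; under [X in _ = _ + X]eq_bigr => i _ do
  rewrite frame_group // scalerDl scaler_suml.
rewrite [X in _ = _ + X]big_split /= addrA; congr (_ + _).
under [X in _ = X + _]eq_bigr => j _ do rewrite rowK mxE scalerBr.
rewrite big_split /= -addrA -[LHS]addr0; congr (_ + _).
rewrite sumrN (partition_big (fun j => g (e j)) xpredT) //= addrC.
apply/esym/eqP; rewrite subr_eq0; apply/eqP; apply: eq_bigr => i _.
by apply: eq_bigr => j /eqP ->.
Qed.

(** A kernel vector of [frame_mx] lifts to weights on [B] with all group totals 0, the weights of
    the [s i] being chosen to balance, hence to a kernel vector of [cayley]. *)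
Lemma frame_mx_unit : indep cayley B -> frame_mx \in unitmx.
Proof.
move=> /indepP iB; rewrite -row_free_unit; apply: inj_row_free => w wX.
have [y yB yE] := frame_lift (fun x => match x with
  inl j => w 0 j | inr i => - \sum_(j | g (e j) == i) w 0 j end).
have ye j : y 0 (e j) = w 0 j by exact: (yE (inl j)).
have yG : y *m groupmx = 0.
  apply/rowP => i; rewrite frame_group // mxE (yE (inr i)).
  by under eq_bigr do rewrite ye; rewrite subrr.
have y0 : y = 0.
  apply: iB => //; rewrite -row_mx0; apply/mul_cayley; split=> //.
  rewrite frame_point // yG (_ : \row__ _ = w) ?wX ?add0r.
    by apply: big1 => i _; rewrite mxE scale0r.
  by apply/rowP => j; rewrite mxE ye.
by apply/rowP => j; rewrite -ye y0 !mxE.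
Qed.

(** A product of open simplices, one for each group: the weights of the [e j] are free and [s i]
    receives what is left of [lam 0 i]. *)
Definition frame_dom lam : set 'rV[R]_n.+1 :=
  [set w | (forall j, 0 < w 0 j) /\
           forall i, \sum_(j | g (e j) == i) w 0 j < lam 0 i].

Lemma open_cellE lam :
  open_cell lam B = [set w *m frame_mx + frame_org lam | w in frame_dom lam].
Proof.
apply/seteqP; split=> [p [y [/mul_cayley[yV yG] yB yp]]|_ [w [w0 wl] <-]].
  have hp x : 0 < y 0 (h x) by apply: yp; rewrite hB imset_f.
  exists (\row_j y 0 (e j)); last by rewrite -yV frame_point // yG.
  split=> [j|i]; first by rewrite mxE (hp (inl j)).
  rewrite -yG frame_group //; under eq_bigr do rewrite mxE.
  by rewrite ltrDl (hp (inr i)).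
have [y yB yE] := frame_lift (fun x => match x with
  inl j => w 0 j | inr i => lam 0 i - \sum_(j | g (e j) == i) w 0 j end).
have ye j : y 0 (e j) = w 0 j by exact: (yE (inl j)).
have yG : y *m groupmx = lam.
  apply/rowP => i; rewrite frame_group // (yE (inr i)).
  by under eq_bigr do rewrite ye; rewrite addrC subrK.
exists y; split=> // [|t]; last first.
  rewrite hB => /imsetP[[j|i] _ ->]; rewrite yE //.
  by rewrite subr_gt0.
apply/mul_cayley; split=> //; rewrite frame_point // yG; congr (_ *m _ + _).
by apply/rowP => j; rewrite mxE ye.
Qed.

Let U (x : 'I_n.+1 + 'I_r) : 'rV[R]_n.+1 := match x with
  inl j => delta_mx 0 j | inr i => \row_j - (g (e j) == i)%:R end.

Let b lam (x : 'I_n.+1 + 'I_r) : R := match x with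
  inl j => 0 | inr i => - lam 0 i end.

Let frame_domE lam : frame_dom lam = [set w | forall x, b lam x < lform (U x) w].
Proof.
have Ul w j : lform (U (inl j)) w = w 0 j.
  rewrite /lform (bigD1 j) //= mxE !eqxx mulr1 big1 ?addr0 // => k kj.
  by rewrite mxE (negbTE kj) andbF mulr0.
have Ur w i : lform (U (inr i)) w = - \sum_(j | g (e j) == i) w 0 j.
  rewrite /lform [in RHS]big_mkcond -sumrN; apply: eq_bigr => j _; rewrite mxE.
  by case: ifP; rewrite ?mulrN ?mulr1 ?mulr0.
apply/seteqP; split => w /=.
  by move=> [h1 h2] [j|i]; rewrite ?Ul ?Ur //= ltrN2.
move=> hw; split=> [j|i]; first by have := hw (inl j); rewrite Ul.
by have := hw (inr i); rewrite Ur /= ltrN2.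
Qed.

Lemma measurable_frame_dom lam : (@leb R n).-caratheodory (frame_dom lam).
Proof. by rewrite frame_domE; exact: caratheodory_polyhedron. Qed.

Lemma bnd_frame_dom lam : bnd (frame_dom lam).
Proof.
exists (\sum_i `|lam 0 i|) => w [w0 wl] j; rewrite !mxE -ler_norml gtr0_norm //.
apply: (@le_trans _ _ `|lam 0 (g (e j))|); last first.
  by rewrite (bigD1 (g (e j))) //= lerDl sumr_ge0.
apply: le_trans (ler_norm _); apply: le_trans (ltW (wl (g (e j)))).
rewrite (bigD1 j) //= lerDl; apply: sumr_ge0 => k _; exact: ltW.
Qed.

Lemma measurable_open_cell lam : indep cayley B ->
  (@leb R n).-caratheodory (open_cell lam B).
Proof.
move=> /frame_mx_unit uX; rewrite open_cellE frame_domE.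
pose Y := invmx frame_mx.
have lformM u x M : lform u (x *m M) = lform (u *m M^T) x.
  rewrite /lform; under eq_bigr do rewrite mxE big_distrl.
  rewrite exchange_big; apply: eq_bigr => k _; rewrite mxE big_distrr.
  by apply: eq_bigr => j _; rewrite mxE /=; ring.
have lformB u x x' : lform u (x - x') = lform u x - lform u x'.
  by rewrite /lform -sumrB; apply: eq_bigr => k _; rewrite !mxE mulrBl.
have := @caratheodory_polyhedron R n _ (fun x => U x *m Y^T)
  (fun x => b lam x + lform (U x *m Y^T) (frame_org lam)).
congr (caratheodory_measurable _ _); apply/seteqP; split => p /=.
  move=> hp; exists ((p - frame_org lam) *m Y); last by rewrite mulmxKV // subrK.
  by move=> x; rewrite lformM lformB ltrBrDr.
move=> [w hw <-] x; rewrite -ltrBrDr -lformB addrK -lformM.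
by rewrite /Y mulmxK.
Qed.

(** Each coordinate is scaled by the weight of its own group; the determinant of this diagonal map
    is the monomial in [open_cell_volume]. *)
Lemma frame_dom_scale lam : (forall i, 0 < lam 0 i) ->
  frame_dom lam = [set w *m diag_mx (\row_j lam 0 (g (e j))) |
                    w in frame_dom (const_mx 1)].
Proof.
move=> lam0; apply/seteqP; split=> [w [w0 wl]|_ [w [w0 wl] <-]].
  exists (\row_j (w 0 j / lam 0 (g (e j)))).
    split=> [j|i]; first by rewrite mxE divr_gt0.
    rewrite (eq_bigr (fun j => w 0 j / lam 0 i)); last first.
      by move=> j /eqP <-; rewrite mxE.
    by rewrite -mulr_suml mxE ltr_pdivrMr ?mul1r.
  by apply/rowP => j; rewrite mul_mx_diag !mxE divfK // gt_eqF.
split=> [j|i]; first by rewrite mul_mx_diag !mxE mulr_gt0.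
rewrite (eq_bigr (fun j => w 0 j * lam 0 i)); last first.
  by move=> j /eqP <-; rewrite mul_mx_diag !mxE.
by rewrite -mulr_suml gtr_pMl //; have := wl i; rewrite mxE.
Qed.

Lemma open_cell_volume lam : (forall i, 0 < lam 0 i) ->
  mu (open_cell lam B) = ((mx_factor frame_mx * fine (mu (frame_dom (const_mx 1)))) *
    \prod_j lam 0 (g (e j)))%:E.
Proof.
move=> lam0; have bD := bnd_frame_dom lam.
have -> : open_cell lam B =
    [set x + frame_org lam | x in [set w *m frame_mx | w in frame_dom lam]].
  by rewrite open_cellE image_comp.
rewrite leb_translate; last exact: bnd_mulmx.
rewrite leb_mulmx //; last exact: measurable_frame_dom.
rewrite {1}frame_dom_scale // leb_diag; last exact: bnd_frame_dom.
  under eq_bigr do rewrite mxE.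
  rewrite -[mu (frame_dom _)]fineK; last by apply/leb_bnd_fin/bnd_frame_dom.
  by rewrite -!EFinM; congr (_%:E); ring.
by move=> i; rewrite mxE.
Qed.

End Frame.

End Cells.

Theorem polytope_sum_volume (R : realType) (n r N : nat) (V : 'M[R]_(N, n.+1))
    (g : 'I_N -> 'I_r) : exists a : {ffun 'I_n.+1 -> 'I_r} -> R,
  forall lam : 'rV[R]_r, (forall i, 0 < lam 0 i) ->
  leb (polytope_sum V g lam) = (\sum_f a f * \prod_j lam 0 (f j))%:E.
Proof.
set A := cayley V g; have [c gen] := generic_cost A.
pose G (B : {set 'I_N}) := `[< lower_cell A c B >] && (#|B| == n.+1 + r)%N.
have GP B : G B -> [/\ lower_cell A c B, indep A B & #|B| = (n.+1 + r)%N].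
  move=> /andP[/asboolP cB /eqP ?]; split=> //.
  by case: cB => u [+ _]; exact: gen.
have /choice[F FP] : forall B, exists a : {ffun 'I_n.+1 -> 'I_r} -> R, G B ->
    forall lam : 'rV[R]_r, (forall i, 0 < lam 0 i) ->
    (@leb R n).-caratheodory (open_cell V g lam B) /\
    leb (open_cell V g lam B) = (\sum_f a f * \prod_j lam 0 (f j))%:E.
  move=> B; have [/GP[_ iB cB]|_] := boolP (G B); last by exists (fun=> 0).
  have [s [e [gs hI hB]]] := cell_enum iB cB.
  pose f0 : {ffun 'I_n.+1 -> 'I_r} := [ffun j => g (e j)].
  exists (fun f => (f == f0)%:R *
    (mx_factor (frame_mx V g s e) * fine (leb (frame_dom g e (const_mx 1))))).
  move=> _ lam lam0; split; first exact: (measurable_open_cell gs hI hB).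
  rewrite (open_cell_volume V gs hI hB lam0) (bigD1 f0) //= eqxx mul1r.
  rewrite [X in _ + X]big1 => [|f /negbTE ->]; last by rewrite !mul0r.
  by rewrite addr0; under [in RHS]eq_bigr do rewrite ffunE.
exists (fun f => \sum_(B | G B) F B f) => lam lam0.
transitivity (\sum_(B | G B) leb (open_cell V g lam B))%E; last first.
  rewrite (eq_bigr (fun B => (\sum_f F B f * \prod_j lam 0 (f j))%:E)); last first.
    by move=> B GB; have [] := FP B GB lam lam0.
  rewrite sumEFin exchange_big; congr (_%:E); apply: eq_bigr => f _.
  by rewrite mulr_suml.
have cellP B p : G B -> open_cell V g lam B p -> polytope_sum V g lam p.
  move=> _ [y [yA yB yp]]; exists y; split=> // t.
  by have [/yp/ltW|/yB ->] := boolP (t \in B).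
apply/eqP; rewrite eq_le; apply/andP; split; last first.
  apply: leb_disjoint_le => [B GB|B GB p|B B' p GB GB' pB pB'].
  - by have [] := FP B GB lam lam0.
  - exact: cellP.
  have [l1 _ _] := GP _ GB; have [l2 _ _] := GP _ GB'.
  by apply/eqP; rewrite finset.eqEsubset !(lower_cell_sub l1 l2 pB pB', lower_cell_sub l2 l1 pB' pB).
(* Points violating the nondegeneracy hypothesis of [lower_cell_exists] lie in some [D B] with [B]
   too small, a null set. *)
pose D (B : {set 'I_N}) := polytope_sum V g lam `&` [set p | exists2 z, supported z B &
    z *m A = row_mx p lam].
apply: (@le_trans _ _ (leb (\bigcup_(B in [set B | G B]) open_cell V g lam B) +
   \sum_(B : {set 'I_N} | (#|B| < n.+1 + r)%N) leb (D B))%E).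
  apply: (@le_trans _ _ (leb (\bigcup_(B in [set B | G B]) open_cell V g lam B `|`
     \bigcup_(B in [set B : {set 'I_N} | (#|B| < n.+1 + r)%N]) D B))).
    apply: leb_le => p [y fy].
    have [[B cB [z zB zA]]|nd] := pselect (exists2 B : {set 'I_N}, (#|B| < n.+1 + r)%N &
        exists2 z, supported z B & z *m A = row_mx p lam).
      by right; exists B => //; split; [exists y | exists z].
    left; have [||B [lB pB cB]] := lower_cell_exists _ gen fy.
    - exact: cayley_kernel_sum0.
    - move=> B z cB zB; apply/eqP => zA; apply: nd; exists B => //; exists z => //.
    by exists B => //=; rewrite /G cB eqxx andbT; apply/asboolP.
  apply: le_trans (outer_measureU2 _ _ _) _; apply: leeD2l.
  by apply: leb_fin_cover => p [B cB DB]; exists B.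
rewrite [X in (_ + X)%E]big1 ?adde0 => [|B cB]; last exact: degenerate_null.
by apply: leb_fin_cover => p [B GB pB]; exists B.
Qed.

(** * Approximation of convex bodies *)

(** Keeping the total weight as a factor, instead of normalising, includes the case of total weight
    0, where any point of [A] will do. *)
Lemma convex_cone_sum (R : realType) (n : nat) (A : set 'rV[R]_n) (I : finType)
    (P : pred I) (w : I -> R) (x : I -> 'rV[R]_n) :
  A !=set0 -> Defs.convex_set A -> (forall i, P i -> 0 <= w i) ->
  (forall i, P i -> A (x i)) ->
  exists2 a, A a & \sum_(i | P i) w i *: x i = (\sum_(i | P i) w i) *: a.
Proof.
move=> [a0 a0A] cA w0 xA.
suff [_ //] : 0 <= \sum_(i | P i) w i /\
  exists2 a, A a & \sum_(i | P i) w i *: x i = (\sum_(i | P i) w i) *: a.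
apply: (big_rec2 (fun u W => 0 <= W /\ exists2 a, A a & u = W *: a)).
  by split=> //; exists a0; rewrite ?scale0r.
move=> i u W Pi [W0 [a aA ->]]; have wi := w0 i Pi; split; first exact: addr_ge0.
have [z|nz] := eqVneq (w i + W) 0.
  exists a0 => //; rewrite z scale0r.
  have -> : w i = 0 by lra.
  have -> : W = 0 by lra.
  by rewrite !scale0r addr0.
have pos : 0 < w i + W by rewrite lt_neqAle eq_sym nz addr_ge0.
exists ((w i / (w i + W)) *: x i + (1 - w i / (w i + W)) *: a).
  apply: (cA _ _ (xA _ Pi) aA).
  by rewrite divr_ge0 ?addr_ge0 // ler_pdivrMr // mul1r lerDl.
rewrite scalerDr !scalerA; congr (_ *: _ + _ *: _); field => //.
Qed.

Section PolytopeSum.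
Variables (R : realType) (n r N : nat) (V : 'M[R]_(N, n.+1)) (g : 'I_N -> 'I_r).
Implicit Types (lam : 'rV[R]_r) (p : 'rV[R]_n.+1).

Lemma polytope_sumD lam lam' p p' :
  polytope_sum V g lam p -> polytope_sum V g lam' p' ->
  polytope_sum V g (lam + lam') (p + p').
Proof.
move=> [y [y0 yE]] [y' [y'0 y'E]]; exists (y + y').
split; first by move=> t; rewrite mxE addr_ge0.
by rewrite mulmxDl yE y'E add_row_mx.
Qed.

Lemma polytope_sumZ lam p (s : R) : 0 <= s ->
  polytope_sum V g lam p -> polytope_sum V g (s *: lam) (s *: p).
Proof.
move=> s0 [y [y0 yE]]; exists (s *: y).
split; first by move=> t; rewrite mxE mulr_ge0.
by rewrite -scalemxAl yE scale_row_mx.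
Qed.

Lemma polytope_sum0 : polytope_sum V g 0 0.
Proof. by exists 0; split=> [t|]; rewrite ?mxE // mul0mx row_mx0. Qed.

Lemma polytope_sum_comb lam (x : 'I_r -> 'rV[R]_n.+1) : (forall i, 0 <= lam 0 i) ->
  (forall i, polytope_sum V g (delta_mx 0 i) (x i)) ->
  polytope_sum V g lam (\sum_i lam 0 i *: x i).
Proof.
move=> lam0 xP; rewrite {1}[lam]row_sum_delta.
apply: (big_rec2 (polytope_sum V g)); first exact: polytope_sum0.
by move=> i p q _ pq; apply: polytope_sumD => //; exact: polytope_sumZ.
Qed.

Lemma polytope_sum_convex lam : Defs.convex_set (polytope_sum V g lam).
Proof.
move=> x y xP yP t /andP[t0 t1].
have -> : lam = t *: lam + (1 - t) *: lam by rewrite -scalerDl addrC subrK scale1r.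
by apply: polytope_sumD; apply: polytope_sumZ => //; rewrite subr_ge0.
Qed.

Lemma polytope_sum_vertex t : polytope_sum V g (delta_mx 0 (g t)) (row t V).
Proof.
exists (delta_mx 0 t); split=> [s|]; first by rewrite mxE ler0n.
apply/mul_cayley; rewrite -!rowE; split=> //.
by apply/rowP => i; rewrite !mxE.
Qed.

End PolytopeSum.

Lemma finite_net (R : realType) (n : nat) (A : set 'rV[R]_n.+1) (e : R) :
  0 < e -> A !=set0 -> bnd A -> exists K (a : nat -> 'rV[R]_n.+1),
    (forall z, A (a z)) /\
    forall x, A x -> exists2 z, (z < K)%N & forall j, `|x 0 j - a z 0 j| <= e.
Proof.
move=> e0 [x0 x0A] [b Ab].
(* [K0] grid cells of mesh [e] per axis cover the interval from [- b] to [b]. One point of [A] is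
   picked in each cell meeting [A], with [x0] as default. *)
pose K0 := (Num.truncn (2 * b / e)).+1.
pose idx (x : 'rV[R]_n.+1) j := Num.truncn ((x 0 j + b) / e).
pose F := {ffun 'I_n.+1 -> 'I_K0}.
pose C (f : F) := [set x | A x /\ forall j, idx x j = f j].
pose a (z : nat) := if insub z is Some i then xget x0 (C (enum_val (i : 'I_#|{: F}|)))
                    else x0.
have aA z : A (a z).
  by rewrite /a; case: insubP => // i _ _; case: xgetP => [x -> []|].
exists #|{: F}|, a; split=> // x xA.
have x0b j : 0 <= (x 0 j + b) / e.
  rewrite divr_ge0 ?(ltW e0) //; have := Ab _ xA j; rewrite !mxE => /andP[? ?]; lra.
have idxK j : (idx x j < K0)%N.
  rewrite ltnS le_truncn // ler_pM2r ?invr_gt0 //.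
  by have := Ab _ xA j; rewrite !mxE => /andP[? ?]; lra.
pose f : F := [ffun j => Ordinal (idxK j)].
exists (enum_rank f) => // j.
have -> : a (enum_rank f) = xget x0 (C f) by rewrite /a valK enum_rankK.
have [yA yf] : C f (xget x0 (C f)).
  by apply: xgetPex; exists x; split=> // i; rewrite ffunE.
set y := xget _ _ in yA yf *.
have y0b : 0 <= (y 0 j + b) / e.
  rewrite divr_ge0 ?(ltW e0) //; have := Ab _ yA j; rewrite !mxE => /andP[? ?]; lra.
have := truncn_itv (x0b j); have := truncn_itv y0b.
have := yf j; rewrite ffunE /= /idx => ->.
set m := Num.truncn _; rewrite -natr1.
rewrite !ler_pdivlMr // !ltr_pdivrMr // => /andP[h1 h2] /andP[h3 h4].
rewrite ler_norml; apply/andP; split; lra.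
Qed.

Lemma family_matrix (R : realType) (n r : nat) (T : finType) (pt : T -> 'rV[R]_n)
    (grp : T -> 'I_r) : exists N (V : 'M[R]_(N, n)) (g : 'I_N -> 'I_r),
  (forall x, exists t, row t V = pt x /\ g t = grp x) /\
  (forall t, exists x, row t V = pt x /\ g t = grp x).
Proof.
exists #|{: T}|, (\matrix_t pt (enum_val t)), (fun t => grp (enum_val t)).
split=> [x|t]; last by exists (enum_val t); rewrite rowK.
by exists (enum_rank x); rewrite rowK enum_rankK.
Qed.

Section Approximation.
Variables (R : realType) (n r : nat) (L : 'I_r -> set 'rV[R]_n.+1).
Hypothesis (bL : forall i, convex_body (L i)).
Implicit Types (lam : 'rV[R]_r).
Local Notation mu := (@leb R n).
Local Notation comb lam := (minkowski_comb (fun i => lam 0 i) L).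

Lemma minkowski_comb_compact lam : compact (comb lam).
Proof.
pose K := [set f : 'I_r -> 'rV[R]_n.+1 | forall i, L i (f i)].
have cK : compact (K : set (prod_topology (fun=> 'rV[R]_n.+1))).
  by apply: tychonoff => i; exact: (bL i).2.1.
have -> : comb lam = [set \sum_i lam 0 i *: f i | f in K].
  by apply/seteqP; split=> [x [f [fK ->]]|x [f fK <-]]; exists f.
apply: continuous_compact cK; apply: continuous_subspaceT.
pose PT := prod_topology (fun _ : 'I_r => 'rV[R]_n.+1).
suff H (s : seq 'I_r) : continuous (fun f : PT => \sum_(i <- s) lam 0 i *: f i).
  exact: H.
elim: s => [|i s IH] f.
  have -> : (fun f : PT => \sum_(i <- [::]) lam 0 i *: f i) = cst 0.
    by apply/funext => h; rewrite big_nil.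
  exact: cst_continuous.
have -> : (fun f : PT => \sum_(j <- i :: s) lam 0 j *: f j) =
    (fun f : PT => lam 0 i *: f i + \sum_(j <- s) lam 0 j *: f j).
  by apply/funext => h; rewrite big_cons.
have FF : Filter (nbhs f) by exact: nbhs_filter.
apply: (@cvgD _ _ _ (nbhs f) FF (fun h => lam 0 i *: h i)); last exact: IH.
apply: cvgZr; exact: (@proj_continuous _ (fun=> 'rV[R]_n.+1) i f).
Qed.

Lemma bodies_bnd : exists b : R, forall i x j, L i x -> `|x 0 j| <= b.
Proof.
have /choice[b bP] : forall i, exists b : R, L i `<=` box (const_mx (- b)) (const_mx b).
  by move=> i; have [_ [/compact_bnd]] := bL i.
exists (\sum_i `|b i|) => i x j /bP /(_ j); rewrite !mxE -ler_norml => h.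
apply: le_trans h _; apply: le_trans (ler_norm _) _.
by rewrite (bigD1 i) //= lerDl sumr_ge0.
Qed.

(* A point at sup-distance at most [e] from [a] lies in the cross-polytope with vertices
   [a +- (n + 1) e e_j]; here [a] ranges over a finite [e]-net of each body. *)
Lemma polytope_approx (e : R) : 0 < e ->
  exists N (V : 'M[R]_(N, n.+1)) (g : 'I_N -> 'I_r),
    (forall i x, L i x -> polytope_sum V g (delta_mx 0 i) x) /\
    (forall t, exists2 a, L (g t) a & forall j, `|V t j - a 0 j| <= n.+1%:R * e).
Proof.
move=> e0; have /choice[K0 /choice[a aP]] : forall i, exists K (a : nat -> 'rV[R]_n.+1),
    (forall z, L i (a z)) /\
    forall x, L i x -> exists2 z, (z < K)%N & forall j, `|x 0 j - a z 0 j| <= e.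
  by move=> i; have [ne [/compact_bnd bd _]] := bL i; exact: finite_net.
pose K := \max_i K0 i.
pose h : R := n.+1%:R * e.
have n0 : 0 < n.+1%:R :> R by rewrite ltr0n.
have h0 : 0 < h by rewrite mulr_gt0.
pose pt (t : 'I_r * 'I_K * 'I_n.+1 * bool) : 'rV[R]_n.+1 :=
  a t.1.1.1 t.1.1.2 + ((-1) ^+ t.2 * h) *: delta_mx 0 t.1.2.
have [N [V [g [ptV Vpt]]]] := family_matrix pt (fun t => t.1.1.1).
exists N, V, g; split=> [i x xL|t]; last first.
  have [[[[i z] j] s] [tV gt]] := Vpt t; rewrite gt /=.
  exists (a i z) => [|k]; first exact: (aP i).1.
  have -> : V t k = row t V 0 k by rewrite mxE.
  rewrite tV /pt !mxE addrAC subrr add0r normrM normrM normr_sign mul1r gtr0_norm //=.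
  by rewrite normr_nat; case: (k == j); rewrite ?mulr1 ?mulr0 -/h ?lexx ?ltW.
have [z zK zx] := (aP i).2 x xL.
have zK' : (z < K)%N by apply: leq_trans zK _; exact: leq_bigmax.
have ptP j (s : bool) : polytope_sum V g (delta_mx 0 i) (a i z + ((-1) ^+ s * h) *: delta_mx 0 j).
  have [t [tV gt]] := ptV (i, Ordinal zK', j, s).
  by have := polytope_sum_vertex V g t; rewrite tV gt.
(* [x] is the average of the [q j], and each [q j] lies on the segment joining two opposite vertices
   of the cross-polytope. *)
pose q j := a i z + (n.+1%:R * (x 0 j - a i z 0 j)) *: delta_mx 0 j.
have qP j : polytope_sum V g (delta_mx 0 i) (q j).
  pose s := (1 + (x 0 j - a i z 0 j) / e) / 2.
  have s01 : 0 <= s <= 1.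
    have := zx j; rewrite ler_norml => /andP[h1 h2].
    have h3 : -1 <= (x 0 j - a i z 0 j) / e by rewrite ler_pdivlMr // mulN1r.
    have h4 : (x 0 j - a i z 0 j) / e <= 1 by rewrite ler_pdivrMr // mul1r.
    by rewrite /s; apply/andP; split; lra.
  have := polytope_sum_convex (ptP j false) (ptP j true) s01.
  congr (polytope_sum _ _ _ _); rewrite /q /s /h.
  by apply/rowP => k; rewrite !mxE; field; rewrite gt_eqF.
have ninv (j : 'I_n.+1) : xpredT j -> 0 <= (n.+1%:R : R)^-1.
  by rewrite invr_ge0 ler0n.
have [y yP yE] := convex_cone_sum (ex_intro _ _ (qP ord0))
  (@polytope_sum_convex _ _ _ _ V g (delta_mx 0 i)) ninv (fun j _ => qP j).
suff -> : x = y by [].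
move: yE.
have s1 : \sum_(j < n.+1) n.+1%:R^-1 = 1 :> R.
  by rewrite sumr_const card_ord -[LHS]mulr_natr mulVf // gt_eqF.
rewrite s1 scale1r => <-.
rewrite /q; under eq_bigr do rewrite scalerDr scalerA mulKf ?gt_eqF //.
rewrite big_split /= -scaler_suml s1 scale1r -{1}(subrK (a i z) x) addrC; congr (_ + _).
rewrite [LHS]row_sum_delta; apply: eq_bigr => j _; congr (_ *: _).
by rewrite !mxE.
Qed.

End Approximation.

(** * Polarization and existence of mixed volumes *)

Section FormLimit.
Variables (R : realType) (n r : nat) (L : 'I_r -> set 'rV[R]_n.+1).
Hypothesis (bL : forall i, convex_body (L i)).
Local Notation mu := (@leb R n).

Definition multiform (a : {ffun 'I_n.+1 -> 'I_r} -> R) (x : 'I_r -> R) : R :=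
  \sum_f a f * \prod_j x (f j).

(** The extra weight [e] adds a translate of [\sum_i e *: c i], which translation invariance removes
    in the lower bound. In the upper bound the vertices are replaced by nearby points of the bodies,
    of total weight at most [\sum_i (lam i + 1)]; the term in [b] pays for the extra weight. *)
Lemma polytope_sandwich (b e : R) (lam : 'I_r -> R) N (V : 'M[R]_(N, n.+1))
    (g : 'I_N -> 'I_r) :
  (forall i x j, L i x -> `|x 0 j| <= b) -> 0 < e <= 1 -> (forall i, 0 <= lam i) ->
  (forall i x, L i x -> polytope_sum V g (delta_mx 0 i) x) ->
  (forall t, exists2 a, L (g t) a & forall j, `|V t j - a 0 j| <= n.+1%:R * e) ->
  let P := polytope_sum V g (\row_i (lam i + e)) in
  (mu (minkowski_comb lam L) <= mu P)%E /\
  P `<=` thicken (minkowski_comb lam L)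
    ((n.+1%:R * \sum_i (lam i + 1) + \sum_(i < r) b) * e).
Proof.
move=> Lb /andP[e0 e1] lam0 LP PL P; split.
  have bC : bnd (minkowski_comb lam L).
    have := compact_bnd (@minkowski_comb_compact _ _ _ _ bL (\row_i lam i)).
    by congr (bnd (minkowski_comb _ _)); apply/funext => i; rewrite mxE.
  have /choice[c cL] : forall i, exists c, L i c by move=> i; have [[c ?] _] := bL i; exists c.
  rewrite -(leb_translate (\sum_i e *: c i) bC).
  apply: leb_le => _ [_ [y [yL ->]] <-].
  have h1 := polytope_sum_comb (V := V) (g := g) (lam := \row_i lam i) (x := y).
  have h2 := polytope_sum_comb (V := V) (g := g) (lam := const_mx e) (x := c).
  have := polytope_sumD (h1 _ _) (h2 _ _).
  have -> : \sum_i (\row_i lam i) 0 i *: y i = \sum_i lam i *: y i.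
    by apply: eq_bigr => i _; rewrite mxE.
  have -> : \sum_i (const_mx e : 'rV_r) 0 i *: c i = \sum_i e *: c i.
    by apply: eq_bigr => i _; rewrite mxE.
  have -> : \row_i lam i + const_mx e = \row_i (lam i + e).
    by apply/rowP => i; rewrite !mxE.
  by apply=> i; rewrite ?mxE ?(ltW e0) //; apply: LP.
have {}/choice[a aP] : forall t, exists a, L (g t) a /\
    forall j, `|V t j - a 0 j| <= n.+1%:R * e.
  by move=> t; have [a ? ?] := PL t; exists a.
move=> p [y [y0 /mul_cayley[yV yG]]].
have yGi i : \sum_(t | g t == i) y 0 t = lam i + e.
  have /rowP/(_ i) := yG; rewrite mul_groupmx mxE => <-.
  by rewrite big_mkcond; apply: eq_bigr => t _; case: eqP; rewrite ?mul1r ?mul0r.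
have /choice[c cP] : forall i, exists c, L i c /\
    \sum_(t | g t == i) y 0 t *: a t = (lam i + e) *: c.
  move=> i; have [nL [_ cL]] := bL i.
  have [||c Lc cE] := @convex_cone_sum _ _ _ _ (fun t => g t == i) (fun t => y 0 t) a nL cL.
  - by move=> t _; exact: y0.
  - by move=> t /eqP <-; exact: (aP t).1.
  by exists c; split=> //; rewrite cE yGi.
exists (\sum_i lam i *: c i) => [|j].
  by exists c; split=> // i; exact: (cP i).1.
have pE : p - \sum_i lam i *: c i =
    \sum_t y 0 t *: (row t V - a t) + e *: \sum_i c i.
  have -> : \sum_t y 0 t *: (row t V - a t) = p - \sum_t y 0 t *: a t.
    by under eq_bigr do rewrite scalerBr; rewrite sumrB -mulmx_sum_row yV.
  have -> : \sum_t y 0 t *: a t = \sum_i (lam i *: c i + e *: c i).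
    rewrite (partition_big g xpredT) //; apply: eq_bigr => i _.
    by rewrite (cP i).2 scalerDl.
  by rewrite big_split /= -scaler_sumr opprD addrA subrK.
have -> : p 0 j - (\sum_i lam i *: c i) 0 j = (p - \sum_i lam i *: c i) 0 j.
  by rewrite !mxE.
rewrite pE mxE mulrDl; apply: le_trans (ler_normD _ _) _; apply: lerD.
  rewrite summxE; apply: le_trans (ler_norm_sum _ _ _) _.
  apply: (@le_trans _ _ (\sum_t y 0 t * (n.+1%:R * e))).
    apply: ler_sum => t _; rewrite !mxE normrM ger0_norm // ler_wpM2l //.
    exact: (aP t).2.
  rewrite -mulr_suml (partition_big g xpredT) //=.
  under eq_bigr do rewrite yGi.
  rewrite mulrA ler_wpM2r ?(ltW e0) // mulrC ler_wpM2l //.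
  by apply: ler_sum => i _; rewrite lerD2l.
rewrite mxE summxE normrM gtr0_norm // mulrC ler_wpM2r ?(ltW e0) //.
apply: le_trans (ler_norm_sum _ _ _) _; apply: ler_sum => i _.
by apply: Lb; exact: (cP i).1.
Qed.

(** One sequence of forms serves every [lam], including those with zero entries, which the shift
    makes positive. *)
Lemma multiform_approx : exists a : nat -> {ffun 'I_n.+1 -> 'I_r} -> R,
  forall lam : 'I_r -> R, (forall i, 0 <= lam i) ->
  (multiform (a k) (fun i => lam i + k.+1%:R^-1)) @[k --> \oo] -->
    Vol (minkowski_comb lam L).
Proof.
have [b Lb] := bodies_bnd bL.
have e01 (k : nat) : 0 < (k.+1%:R^-1 : R) <= 1.
  by rewrite invr_gt0 ltr0n /= invf_le1 ?ltr0n // ler1n.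
pose C (lam : 'I_r -> R) := n.+1%:R * \sum_i (lam i + 1) + \sum_(i < r) b.
have /choice[a aP] : forall k, exists a : {ffun 'I_n.+1 -> 'I_r} -> R,
    forall lam : 'I_r -> R, (forall i, 0 <= lam i) ->
    (mu (minkowski_comb lam L) <=
      (multiform a (fun i => lam i + k.+1%:R^-1))%:E <=
     mu (thicken (minkowski_comb lam L) (C lam * k.+1%:R^-1)))%E.
  move=> k; have /andP[e0 e1] := e01 k.
  have [N [V [g [LP PL]]]] := polytope_approx bL e0.
  have [a aP] := polytope_sum_volume V g; exists a => lam lam0.
  have [h1 h2] := polytope_sandwich Lb (e01 k) lam0 LP PL.
  have aE : mu (polytope_sum V g (\row_i (lam i + k.+1%:R^-1))) =
      (multiform a (fun i => lam i + k.+1%:R^-1))%:E.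
    rewrite aP => [|i]; last by rewrite mxE ltr_wpDl.
    by congr (_%:E); apply: eq_bigr => f _; under eq_bigr do rewrite mxE.
  by rewrite -aE h1 leb_le.
exists a => lam lam0; set K := minkowski_comb lam L.
have cK : compact K.
  have := @minkowski_comb_compact _ _ _ _ bL (\row_i lam i).
  by congr (compact (minkowski_comb _ _)); apply/funext => i; rewrite mxE.
have finK : mu K \is a fin_num by exact/leb_bnd_fin/compact_bnd.
apply/cvgrPdist_le => d d0.
have [e e0 le] := leb_outer_regular cK d0.
have C0 : 0 <= `|C lam| + 1 by rewrite addr_ge0.
have [k0 hk0] : exists k0 : nat, forall k, (k0 <= k)%N -> C lam * k.+1%:R^-1 <= e.
  exists (Num.truncn (`|C lam| / e)) => k kk.
  rewrite ler_pdivrMr ?ltr0n //; apply: le_trans (ler_norm _) _.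
  rewrite mulrC -ler_pdivrMr //; apply: ltW.
  have /andP[_ h] := @truncn_itv _ (`|C lam| / e) (divr_ge0 (normr_ge0 _) (ltW e0)).
  by apply: lt_le_trans h _; rewrite ler_nat ltnS.
exists k0 => // k /= kk; have /andP[h1 h2] := aP k lam lam0.
have h3 : (mu (thicken K (C lam * k.+1%:R^-1)) <= mu (thicken K e))%E.
  by apply: leb_le => x [y yK xy]; exists y => // j; apply: le_trans (xy j) (hk0 k kk).
have := le_trans h2 (le_trans h3 le); move: h1.
rewrite -(fineK finK) -EFinD !lee_fin => h4 h5.
by rewrite ler_norml; apply/andP; split; rewrite /Vol -/(mu K) -/K; lra.
Qed.

End FormLimit.

Section Polarization.

(* [(-1) ^+ (n - #|S|)], in the product form to which [bigA_distr] applies. *)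
Definition alt_sign (K : pzRingType) (I : finType) (S : {set I}) : K :=
  \prod_i (if i \in S then 1 else -1).

(* Expand the product over [j]: after summation over [S], a choice [phi] of indices that misses
   some [l] gets the factor [1 - 1], so only the bijective choices survive. *)
Lemma polarization (K : comPzRingType) (n : nat) (x : 'I_n -> K) (E : 'I_n -> 'I_n -> K) :
  \sum_(S : {set 'I_n}) alt_sign K S * \prod_j (x j + \sum_(l in S) E l j) =
  \sum_(s : {perm 'I_n}) \prod_j E (s j) j.
Proof.
pose In (S : {set 'I_n}) (o : option 'I_n) : K :=
  if o is Some l then (l \in S)%:R else 1.
pose E' (j : 'I_n) (o : option 'I_n) : K := if o is Some l then E l j else x j.
transitivity (\sum_(phi : {ffun 'I_n -> option 'I_n})
    (\prod_j E' j (phi j)) * \sum_(S : {set 'I_n}) alt_sign K S * \prod_j In S (phi j)).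
  under [RHS]eq_bigr do rewrite mulr_sumr.
  rewrite exchange_big; apply: eq_bigr => S _ /=.
  transitivity (alt_sign K S * \prod_j \sum_(o : option 'I_n) E' j o * In S o).
    congr (_ * _); apply: eq_bigr => j _.
    rewrite (bigD1 None) //= mulr1; congr (_ + _).
    rewrite big_mkcond [RHS](reindex_omap Some id) /=.
      by rewrite [RHS]big_mkcond; apply: eq_bigr => l _; rewrite eqxx; case: (_ \in _); rewrite ?mulr1 ?mulr0.
    by case.
  rewrite bigA_distr_bigA mulr_sumr; apply: eq_bigr => phi _.
  by rewrite big_split /=; ring.
have alt (phi : {ffun 'I_n -> option 'I_n}) : \sum_(S : {set 'I_n}) alt_sign K S * \prod_j In S (phi j) =
    [forall l, Some l \in codom phi]%:R.
  transitivity (\prod_(l : 'I_n) (1 + - (Some l \notin codom phi)%:R) : K).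
    rewrite bigA_distr; apply: eq_bigr => S _.
    have [sub|/forallPn[l]] := boolP [forall l, (Some l \in codom phi) ==> (l \in S)].
      rewrite big1 ?mulr1 => [|j _]; last first.
        rewrite /In; case pj: (phi j) => [l|] //.
        by have := forallP sub l; rewrite -pj codom_f /= => ->.
      apply: eq_bigr => l _; case: ifP => // lS.
      by have := forallP sub l; rewrite lS implybF => ->.
    rewrite negb_imply => /andP[/codomP[j pj] lS].
    rewrite (bigD1 j) //= /In -pj (negbTE lS) mul0r mulr0.
    rewrite (bigD1 l) //= (negbTE lS) (_ : (_ \notin _) = false) ?oppr0 ?mul0r //.
    by rewrite pj codom_f.
  have [/forallP h|/forallPn[l /negPf h]] := boolP [forall l, Some l \in codom phi].
    by rewrite big1 // => l _; rewrite h subr0.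
  by rewrite (bigD1 l) //= h subrr mul0r.
under eq_bigr do rewrite alt.
rewrite (bigID (fun phi : {ffun 'I_n -> option 'I_n} => [forall l, Some l \in codom phi])) /=.
rewrite [X in _ + X]big1 ?addr0 => [|phi /negbTE ->]; last by rewrite mulr0.
pose F (s : {perm 'I_n}) : {ffun 'I_n -> option 'I_n} := [ffun j => Some (s j)].
have FI : injective F.
  move=> s t /ffunP st; apply/permP => j; have := st j.
  by rewrite !ffunE => -[].
rewrite (eq_bigl (fun phi => phi \in [set F s | s in [set: {perm 'I_n}]%SET]%SET)).
  rewrite big_imset /=; last by apply: in2W.
  apply: eq_big => s; first by rewrite finset.in_setT.
  move=> _; rewrite (_ : [forall l, _]) ?mulr1.
    by apply: eq_bigr => j _; rewrite ffunE.
  apply/forallP => l; apply/codomP; exists ((s^-1)%g l).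
  by rewrite ffunE permKV.
move=> phi; apply/forallP/imsetP => [h|[s _ ->] l]; last first.
  by apply/codomP; exists ((s^-1)%g l); rewrite ffunE permKV.
have /choice[u uP] : forall l, exists j, phi j = Some l.
  by move=> l; have /codomP[j ->] := h l; exists j.
have uI : injective u by move=> l l' /(congr1 phi); rewrite !uP => -[].
exists (perm uI)^-1%g => //; apply/ffunP => j; rewrite ffunE -uP.
by rewrite -(permE uI) permKV.
Qed.

End Polarization.

(** By convexity, multiples of the same body add up to one multiple of it with the summed weight. *)
Lemma minkowski_comb_regroup (R : realType) (n m r : nat) (L : 'I_r -> set 'rV[R]_n)
    (f : 'I_m -> 'I_r) (w : 'I_m -> R) :
  (forall i, convex_body (L i)) -> (forall j, 0 <= w j) ->
  minkowski_comb w (fun j => L (f j)) =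
  minkowski_comb (fun i => \sum_(j | f j == i) w j) L.
Proof.
move=> bL w0; apply/seteqP; split=> [x [y [yL ->]]|x [y [yL ->]]]; last first.
  exists (fun j => y (f j)); split=> //.
  rewrite [RHS](partition_big f xpredT) //=; apply: eq_bigr => i _.
  by rewrite scaler_suml; apply: eq_bigr => j /eqP ->.
have /choice[c cP] : forall i, exists c, L i c /\
    \sum_(j | f j == i) w j *: y j = (\sum_(j | f j == i) w j) *: c.
  move=> i; have [nL [_ cL]] := bL i.
  have [||c Lc cE] := @convex_cone_sum _ _ _ _ (fun j => f j == i) w y nL cL.
  - by move=> j _; exact: w0.
  - by move=> j /eqP <-.
  by exists c.
exists c; split=> [i|]; first exact: (cP i).1.
by rewrite (partition_big f xpredT) //=; apply: eq_bigr => i _; rewrite (cP i).2.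
Qed.

Lemma minkowski_comb_perm (R : realType) (n m : nat) (M : 'I_m -> set 'rV[R]_n)
    (s : {perm 'I_m}) (w : 'I_m -> R) :
  minkowski_comb (fun j => w (s j)) (fun j => M (s j)) = minkowski_comb w M.
Proof.
apply/seteqP; split=> x [y [yM ->]].
  exists (fun j => y ((s^-1)%g j)); split=> [j|].
    by have := yM ((s^-1)%g j); rewrite permKV.
  by rewrite [RHS](reindex_perm s) /=; apply: eq_bigr => j _; rewrite permK.
exists (fun j => y (s j)); split=> // .
by rewrite (reindex_perm s).
Qed.

Section MultiformPolarization.
Variables (R : realType) (n r : nat) (a : {ffun 'I_n.+1 -> 'I_r} -> R).

Lemma multiform_polarization (e : R) (x : 'I_r -> R) :
  \sum_(f : {ffun 'I_n.+1 -> 'I_r})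
    ((n.+1)`!%:R^-1 * \sum_(S : {set 'I_n.+1}) alt_sign R S *
      multiform a (fun i => \sum_(l | f l == i) (l \in S)%:R + e)) * \prod_j x (f j)
  = multiform a x.
Proof.
transitivity (\sum_(f : {ffun 'I_n.+1 -> 'I_r}) \sum_h \sum_(s : {perm 'I_n.+1})
   (n.+1)`!%:R^-1 * a h * \prod_j ((f j == h ((s^-1)%g j))%:R * x (f j))).
  apply: eq_bigr => f _.
  have -> : \sum_(S : {set 'I_n.+1}) alt_sign R S *
      multiform a (fun i => \sum_(l | f l == i) (l \in S)%:R + e) =
      \sum_h a h * \sum_(s : {perm 'I_n.+1}) \prod_j (f (s j) == h j)%:R.
    under eq_bigr do rewrite /multiform mulr_sumr.
    rewrite exchange_big; apply: eq_bigr => h _ /=.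
    rewrite -(polarization (fun=> e) (fun l j => (f l == h j)%:R)) mulr_sumr; apply: eq_bigr => S _.
    rewrite mulrCA; congr (_ * (_ * _)); apply: eq_bigr => j _.
    rewrite addrC; congr (_ + _); rewrite big_mkcond [RHS]big_mkcond.
    by apply: eq_bigr => l _; do 2 case: ifP.
  rewrite mulr_sumr mulr_suml; apply: eq_bigr => h _.
  rewrite mulrA -mulrA mulr_suml mulr_sumr; apply: eq_bigr => s _; congr (_ * _).
  rewrite big_split /=; congr (_ * _).
  by rewrite [RHS](reindex_perm s); apply: eq_bigr => j _; rewrite permK.
rewrite exchange_big; apply: eq_bigr => h _ /=; rewrite exchange_big /=.
transitivity (\sum_(s : {perm 'I_n.+1}) (n.+1)`!%:R^-1 * (a h * \prod_j x (h j))).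
  apply: eq_bigr => s _; rewrite -mulr_sumr -mulrA; congr (_ * (_ * _)).
  rewrite -(bigA_distr_bigA (fun j i => (i == h ((s^-1)%g j))%:R * x i)) /=.
  rewrite [RHS](reindex_perm s^-1%g) /=; apply: eq_bigr => j _.
  rewrite (bigD1 (h ((s^-1)%g j))) //= eqxx mul1r big1 ?addr0 // => i /negbTE ->.
  by rewrite mul0r.
rewrite sumr_const (_ : #|_| = (n.+1)`!); last first.
  by rewrite -[RHS](card_Sn n.+1); apply: eq_card.
rewrite -[LHS]mulr_natl mulrA divff ?mul1r //.
Qed.

End MultiformPolarization.

(** The inclusion-exclusion formula for mixed volumes. Bodies with index outside [S] stay in the
    combination with weight 0, where a nonempty body contributes only the origin. *)
Definition mixed_vol (R : realType) (n : nat) (M : 'I_n.+1 -> set 'rV[R]_n.+1) : R :=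
  (n.+1)`!%:R^-1 * \sum_(S : {set 'I_n.+1}) alt_sign R S *
    Vol (minkowski_comb (fun j => (j \in S)%:R) M).

Theorem mixed_vol_exists (R : realType) (n : nat) : is_mixed_volume (@mixed_vol R n).
Proof.
split=> [L s _|r L lam bL lam0].
  congr (_ * _); rewrite [RHS](reindex_inj (imset_inj (perm_inj (s := s)))) /=.
  apply: eq_bigr => S _; congr (_ * @Vol R n.+1 _).
    rewrite /alt_sign [RHS](reindex_perm s) /=; apply: eq_bigr => i _.
    by rewrite mem_imset //; exact: perm_inj.
  rewrite -[RHS](minkowski_comb_perm _ s); congr minkowski_comb; apply/funext => j.
  by rewrite mem_imset //; exact: perm_inj.
have [a aP] := multiform_approx bL.
pose e (k : nat) : R := k.+1%:R^-1.
have lam0' i : 0 <= lam i by exact/ltW.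
have cvg_e x : (x + e k) @[k --> \oo] --> (x : R).
  by rewrite -[X in _ --> X]addr0; apply: cvgD; [exact: cvg_cst | exact: cvg_harmonic].
(* The same sequence of values tends to the volume and, once rewritten by polarization, to the mixed
   volume expansion. *)
apply: (@cvg_unique _ _ _ _ _ _ (aP lam lam0')) => //.
rewrite (_ : (fun k => _) = (fun k => \sum_(f : {ffun 'I_n.+1 -> 'I_r})
    ((n.+1)`!%:R^-1 * \sum_(S : {set 'I_n.+1}) alt_sign R S *
      multiform (a k) (fun i => \sum_(l | f l == i) (l \in S)%:R + e k)) *
      \prod_j (lam (f j) + e k))); last first.
  apply/funext => k.
  exact/esym/(multiform_polarization (a k) (e k) (fun i => lam i + e k)).
apply: cvg_big => [|f _]; first exact: add_continuous.
apply: cvgM; last first.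
  apply: cvg_big => [|j _]; [exact: mul_continuous | exact: cvg_e].
apply: cvgM; first exact: cvg_cst.
apply: cvg_big => [|S _]; first exact: add_continuous.
apply: cvgM; first exact: cvg_cst.
rewrite minkowski_comb_regroup //.
by apply: aP => i; apply: sumr_ge0 => l _; exact: ler0n.
Qed.

(** * Coordinate cubes *)

Section BoxBodies.
Variables (R : realType) (n : nat).
Implicit Types (a b : 'rV[R]_n).

Lemma box_convex_body b : (forall l, 0 <= b 0 l) -> convex_body (box 0 b).
Proof.
move=> b0; split; first by exists 0 => l; rewrite mxE lexx b0.
split.
  have := @rV_compact _ n (fun l => `[0, b 0 l]%classic) (fun l => @segment_compact R _ _).
  congr compact; apply/seteqP; split=> x /= xb l; have := xb l;
    by rewrite ?in_itv /= !mxE.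
move=> x y xb yb t /andP[t0 t1] l; rewrite !mxE.
have := xb l; have := yb l; rewrite !mxE => /andP[y0 y1] /andP[x0 x1].
have t1' : 0 <= 1 - t by rewrite subr_ge0.
rewrite addr_ge0 ?mulr_ge0 //=.
apply: (@le_trans _ _ (t * b 0 l + (1 - t) * b 0 l)); last by rewrite -mulrDl addrC subrK mul1r.
by apply: lerD; apply: ler_wpM2l.
Qed.

Lemma minkowski_comb_box (r : nat) (lam : 'I_r -> R) (b : 'I_r -> 'rV[R]_n) :
  (forall i, 0 < lam i) -> (forall i l, 0 <= b i 0 l) ->
  minkowski_comb lam (fun i => box 0 (b i)) = box 0 (\sum_i lam i *: b i).
Proof.
move=> lam0 b0; have sE l : (\sum_i lam i *: b i) 0 l = \sum_i lam i * b i 0 l.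
  by rewrite summxE; apply: eq_bigr => i _; rewrite mxE.
apply/seteqP; split=> x.
  move=> [y [yb ->]] l; rewrite summxE sE mxE; apply/andP; split.
    apply: sumr_ge0 => i _; rewrite mxE mulr_ge0 ?(ltW (lam0 i)) //.
    by have := yb i l; rewrite mxE => /andP[].
  apply: ler_sum => i _; rewrite mxE ler_wpM2l ?(ltW (lam0 i)) //.
  by have := yb i l => /andP[].
(* Each coordinate of [x] is split in proportion to the sides. Where the total side is 0, the
   quotient is 0 by convention and [x 0 l] is 0 as well. *)
move=> xb; exists (fun i => \row_l (b i 0 l * (x 0 l / \sum_j lam j * b j 0 l))).
have s0 l : 0 <= \sum_j lam j * b j 0 l.
  by apply: sumr_ge0 => j _; rewrite mulr_ge0 ?(ltW (lam0 j)).
have xs l : 0 <= x 0 l <= \sum_j lam j * b j 0 l.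
  by have := xb l; rewrite sE mxE.
split=> [i l|].
  rewrite !mxE; have /andP[x0 x1] := xs l; rewrite mulr_ge0 ?divr_ge0 //=.
  rewrite ler_piMr //; have [z|nz] := eqVneq (\sum_j lam j * b j 0 l) 0.
    by rewrite z invr0 mulr0 ler01.
  by rewrite ler_pdivrMr ?mul1r // lt_neqAle eq_sym nz s0.
apply/rowP => l; rewrite summxE.
under eq_bigr do rewrite !mxE mulrA.
rewrite -mulr_suml; have [z|nz] := eqVneq (\sum_j lam j * b j 0 l) 0.
  by rewrite z mul0r; have := xs l; rewrite z -eq_le => /eqP.
by rewrite mulrC divfK.
Qed.

Lemma Vol_box a b : (0 < n)%N -> Vol (box a b) = box_vol a b.
Proof.
case: n a b => // n' a b _.
by have := leb_box a b; rewrite /leb /Vol => ->.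
Qed.

End BoxBodies.

Lemma poly_eq_pos (R : realFieldType) (p q : {poly R}) :
  (forall x, 0 < x -> p.[x] = q.[x]) -> p = q.
Proof.
move=> pq; apply/eqP; rewrite -subr_eq0; apply: contraT => nz.
pose s := [seq (i.+1%:R : R) | i <- iota 0 (size (p - q))].
have rs : all (root (p - q)) s.
  by apply/allP => _ /mapP[i _ ->]; rewrite /root !hornerE pq ?subrr //.
have us : uniq s.
  rewrite map_inj_uniq ?iota_uniq // => i j /eqP.
  by rewrite eqr_nat => /eqP[].
by have := max_poly_roots nz rs us; rewrite size_map size_iota ltnn.
Qed.

Lemma eq_fibers_perm (n : nat) (f f' : 'I_n -> 'I_2) :
  #|[set j | f j == ord0]%SET| = #|[set j | f' j == ord0]%SET| ->
  exists s : {perm 'I_n}, forall j, f j = f' (s j).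
Proof.
move=> ff'.
have cnt (h : 'I_n -> 'I_2) i : count_mem i [tuple h j | j < n] =
    if i == ord0 then #|[set j | h j == ord0]%SET| else (n - #|[set j | h j == ord0]%SET|)%N.
  have -> : count_mem i [tuple h j | j < n] = #|[set j | h j == i]%SET|.
    rewrite /= count_map enumT cardE size_filter; apply: eq_count => j.
    by rewrite /= inE.
  case: ifPn => [/eqP -> //|i0].
  have := cardsC [set j | h j == ord0]%SET; rewrite card_ord => hc.
  apply: (@addnI #|[set j | h j == ord0]%SET|).
  rewrite subnKC; last by rewrite -[leqRHS]hc leq_addr.
  rewrite -[RHS]hc; congr (_ + _)%N; apply: eq_card => j; rewrite !inE.
  by case: (h j) i i0 => [[|[|?]] ?] [[|[|?]] ?].
have /tuple_permP[s sE] : perm_eq [tuple f j | j < n] [tuple f' j | j < n].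
  by apply/allP => i _; apply/eqP; rewrite /= !cnt ff'.
exists s => j; have := congr1 (fun t : n.-tuple 'I_2 => tnth t j) (val_inj sE).
by rewrite !tnth_mktuple.
Qed.

Section CoordinateCubes.
Variables (R : realType) (n k : nat).
Hypotheses (nk : n = (2 * k)%N) (k0 : (0 < k)%N).
Implicit Types (S T : {set 'I_n}).

Definition coord_cube S : set 'rV[R]_n := box 0 (\row_l (l \in S)%:R).

Lemma coord_cube_body S : convex_body (coord_cube S).
Proof. by apply: box_convex_body => l; rewrite mxE ler0n. Qed.

(** Since [T] and the complement of [S] have the same size, any other [T] misses a coordinate
    outside [S], and the box is flat in that direction. *)
Lemma coord_cubes_vol S T (x : R) : #|S| = k -> #|T| = k -> 0 < x ->
  Vol (minkowski_comb (fun i : 'I_2 => if i == ord0 then x else 1)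
    (fun i => coord_cube (if i == ord0 then S else T))) = (T == ~: S)%SET%:R * x ^+ k.
Proof.
move=> cS cT x0; rewrite minkowski_comb_box; last 2 first.
- by move=> i; case: ifP.
- by move=> i l; rewrite mxE ler0n.
rewrite Vol_box ?nk ?muln_gt0 // big_ord_recl big_ord1 /=.
have -> : box_vol (0 : 'rV[R]_n) (x *: (\row_l (l \in S)%:R) + 1 *: (\row_l (l \in T)%:R)) =
    \prod_l (x * (l \in S)%:R + (l \in T)%:R).
  apply: eq_bigr => l _; rewrite !mxE subr0 mul1r max_l //.
  by rewrite addr_ge0 ?mulr_ge0 ?ler0n // ltW.
have cSC : #|(~: S)%SET| = k by rewrite finset.cardsCs finset.setCK card_ord cS nk mul2n -addnn addnK.
have [->|nTS] := eqVneq T (~: S)%SET.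
  rewrite mul1r (eq_bigr (fun l => if l \in S then x else 1)); last first.
    by move=> l _; rewrite finset.in_setC; case: (l \in S); rewrite ?mulr1 ?mulr0 ?addr0 ?add0r.
  by rewrite -big_mkcond prodr_const cS.
have [l lS lT] : exists2 l, l \notin S & l \notin T.
  have : ~~ ((~: S)%SET \subset T).
    by apply: contra nTS => sub; rewrite eq_sym eqEcard sub cSC cT leqnn.
  by move=> /fintype.subsetPn[l]; rewrite finset.in_setC => ? ?; exists l.
by rewrite mul0r (bigD1 l) //= (negbTE lS) (negbTE lT) mulr0 addr0 mul0r.
Qed.

(** Its cardinality, the binomial coefficient of [2 * k] over [k], counts the equal terms in the
    coefficient of [x ^+ k]. *)
Definition half_fibers : {set {ffun 'I_n -> 'I_2}} :=
  [set f : {ffun 'I_n -> 'I_2} | #|[set j | f j == ord0]%SET| == k]%SET.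

Let f0 : {ffun 'I_n -> 'I_2} := [ffun j : 'I_n => if (j < k)%N then ord0 else ord_max].

Lemma card_lt_half : #|[set j : 'I_n | (j < k)%N]%SET| = k.
Proof.
have kn : (k <= n)%N by rewrite nk mul2n -addnn leq_addr.
by rewrite cardsE -sum1_card -(big_ord_widen n (fun=> 1%N) kn) sum1_card card_ord.
Qed.

Lemma f0_fiber : #|[set j | f0 j == ord0]%SET| = k.
Proof.
by rewrite -[RHS]card_lt_half; apply: eq_card => j; rewrite !inE ffunE; case: ifP.
Qed.

Lemma half_fibers_gt0 : (0 < #|half_fibers|)%N.
Proof. by apply/card_gt0P; exists f0; rewrite inE f0_fiber. Qed.

(* Compare the coefficients of [x ^+ k] in the volume of [x K_S + K_T]. *)
Lemma mixed_volume_coord_cubes (V : ('I_n -> set 'rV[R]_n) -> R)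
    (C : 'I_(n - 2 * k) -> set 'rV[R]_n) S T :
  is_mixed_volume V -> #|S| = k -> #|T| = k ->
  V (@mv_args R n k (coord_cube S) (coord_cube T) C) =
  #|half_fibers|%:R^-1 * (T == ~: S)%SET%:R.
Proof.
move=> [Vsym Vpol] cS cT.
pose L (i : 'I_2) := coord_cube (if i == ord0 then S else T).
have bL i : convex_body (L i) by exact: coord_cube_body.
have -> : @mv_args R n k (coord_cube S) (coord_cube T) C = (fun j => L (f0 j)).
  apply/funext => j; rewrite /mv_args /L ffunE; case: ifP => // _.
  by have := ltn_ord j; rewrite {2}nk => ->.
pose e (f : {ffun 'I_n -> 'I_2}) := #|[set j | f j == ord0]%SET|.
have peq : \sum_(f : {ffun 'I_n -> 'I_2}) (V (fun j => L (f j))) *: 'X^(e f) =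
    (T == ~: S)%SET%:R *: 'X^k.
  apply: poly_eq_pos => x x0; rewrite !hornerE -(coord_cubes_vol cS cT x0).
  rewrite (Vpol 2 L) // => [|i]; last by case: ifP.
  rewrite horner_sum; apply: eq_bigr => f _; rewrite !hornerE; congr (_ * _).
  by rewrite -big_mkcond prodr_const /e cardsE.
have := congr1 (fun p : {poly R} => p`_k) peq.
rewrite coef_sum coefZ coefXn eqxx mulr1 => <-.
rewrite (bigID (mem half_fibers)) /= [X in _ + X]big1 ?addr0 => [|f]; last first.
  by rewrite inE coefZ coefXn eq_sym => /negbTE ->; rewrite mulr0.
rewrite (eq_bigr (fun=> V (fun j => L (f0 j)))) => [|f]; last first.
  rewrite inE => /eqP ef; rewrite coefZ coefXn /e ef eqxx mulr1.
  (* Any [f] taking the value [ord0] exactly [k] times is a rearrangement of [f0], so symmetry of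
     [V] makes all these terms equal. *)
  have [s sE] : exists s : {perm 'I_n}, forall j, f j = f0 (s j).
    by apply: eq_fibers_perm; rewrite f0_fiber.
  rewrite -(Vsym (fun j => L (f0 j)) s) //; congr V.
  by apply/funext => j; rewrite sE.
rewrite sumr_const -[V _ *+ _]mulr_natl mulKf // pnatr_eq0 -lt0n.
exact: half_fibers_gt0.
Qed.

Hypothesis k1 : (2 <= k)%N.

(* [A] is the set of the first [k] coordinates; exchanging one of them with an outside coordinate
   gives [B]. *)
Lemma two_complementary_pairs : exists A B : {set 'I_n},
  [/\ #|A| = k, #|B| = k & [/\ A != B, A != (~: A)%SET, B != (~: B)%SET & A != (~: B)%SET]].
Proof.
have n2 : (k < n)%N by rewrite nk mul2n -addnn -{1}[k]addn0 ltn_add2l.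
pose o0 : 'I_n := Ordinal (leq_ltn_trans (leq0n k) n2).
pose o1 : 'I_n := Ordinal (leq_trans k1 (ltnW n2)).
pose ok : 'I_n := Ordinal n2.
pose A := [set j : 'I_n | (j < k)%N]%SET.
pose B := (tperm o1 ok @: A)%SET.
have tI : injective (tperm o1 ok) by exact: perm_inj.
have A0 : o0 \in A by rewrite inE.
have A1 : o1 \in A by rewrite inE.
have B0 : o0 \in B.
  have <- : tperm o1 ok o0 = o0.
    by rewrite tpermD // -val_eqE /= -?lt0n ?gtn_eqF // (leq_trans _ k1).
  by rewrite mem_imset.
have B1 : o1 \notin B by rewrite -(tpermR o1 ok) mem_imset // inE ltnn.
have neqC (X Y : {set 'I_n}) : o0 \in X -> o0 \in Y -> X != (~: Y)%SET.
  by move=> X0 Y0; apply/eqP => XY; move: X0; rewrite XY finset.in_setC Y0.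
exists A, B; split; [exact: card_lt_half | by rewrite card_imset // card_lt_half |].
split; [|exact: neqC|exact: neqC|exact: neqC].
by apply/eqP => AB; rewrite -AB A1 in B1.
Qed.

End CoordinateCubes.

Lemma det_double_transposition (R : comPzRingType) (c : R) (s : {perm 'I_4}) :
  odd_perm s = false ->
  \det (\matrix_(i < 4, j < 4) (c * (s i == j)%:R)) = c ^+ 4.
Proof.
move=> so; rewrite (_ : \matrix_(i, j) _ = c *: perm_mx s).
  by rewrite detZ det_perm so mulr1.
by apply/matrixP => i j; rewrite !mxE.
Qed.

Theorem theorem1p4 (R : realType) (k : nat) : (2 <= k)%N ->
  exists (n m : nat) (K : 'I_m -> set 'rV[R]_n) (C : 'I_(n - 2 * k) -> set 'rV[R]_n),
    (2 * k <= n)%N /\ (2 < m)%N /\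
        (forall i, convex_body (K i)) /\
        (forall i, convex_body (C i)) /\
        (exists V, @is_mixed_volume R n V) /\
        (forall V : ('I_n -> set 'rV[R]_n) -> R, is_mixed_volume V ->
           0 < (-1) ^+ m * \det (\matrix_(i < m, j < m) V (@mv_args R n k (K i) (K j) C))).
Proof.
move=> k2; have k0 : (0 < k)%N by exact: ltnW.
have [n nk] : exists n, n = (2 * k)%N by exists (2 * k)%N.
have [A [B [cA cB [AB AA BB ABC]]]] := two_complementary_pairs nk k0 k2.
(* Indices 0, 1, 2, 3 stand for [A], its complement, [B] and its complement, so complementation
   swaps 0 with 1 and 2 with 3. *)
pose S (i : 'I_4) : {set 'I_n} :=
  let X := if (i < 2)%N then A else B in if odd i then (~: X)%SET else X.
have cS i : #|S i| = k.
  have cC (X : {set 'I_n}) : #|X| = k -> #|(~: X)%SET| = k.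
    by move=> cX; rewrite finset.cardsCs finset.setCK card_ord cX nk mul2n -addnn addnK.
  by rewrite /S; case: ifP => _; case: ifP => _ //; exact: cC.
exists n, 4, (fun i => @coord_cube R n (S i)), (fun=> set0).
split; first by rewrite nk.
split=> //; split; first by move=> i; exact: coord_cube_body.
split; first by case=> i; rewrite {1}nk subnn.
split.
  have : (0 < n)%N by rewrite nk muln_gt0.
  by case: (n) => // n' _; exists (@mixed_vol R n'); exact: mixed_vol_exists.
move=> V hV.
(* A product of two transpositions is even, so the determinant is the fourth power of a positive
   number, and [(-1) ^+ 4] is 1. *)
have [s sE so] : exists2 s : {perm 'I_4},
    forall i, (s i : nat) = (if odd i then i.-1 else i.+1) & odd_perm s = false.
  exists (tperm (inord 0) (inord 1) * tperm (inord 2) (inord 3))%g.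
    move=> i; rewrite permM; case: i => [[|[|[|[|//]]]] hi];
      by rewrite !permE /= -!val_eqE /= !inordK //= -!val_eqE /= !inordK.
  by rewrite odd_permM !odd_tperm -!val_eqE /= !inordK.
rewrite (_ : \matrix_(_, _) _ =
    \matrix_(i < 4, j < 4) (#|half_fibers n k|%:R^-1 * (s i == j)%:R)).
  rewrite det_double_transposition // -signr_odd mul1r exprn_gt0 //.
  by rewrite invr_gt0 ltr0n half_fibers_gt0.
apply/matrixP => i j; rewrite !mxE (mixed_volume_coord_cubes nk k0) //.
congr (_ * (nat_of_bool _)%:R); rewrite -[RHS](inj_eq val_inj) /= sE.
have CE (X Y : {set 'I_n}) : ((~: X)%SET == (~: Y)%SET) = (X == Y).
  exact: (inj_eq (@finset.setC_inj _)).
have BA : (B == A) = false by rewrite eq_sym; exact: negbTE.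
have BAC : (B == (~: A)%SET) = false.
  by rewrite -CE finset.setCK eq_sym; exact: negbTE.
by case: i => [[|[|[|[|//]]]] hi]; case: j => [[|[|[|[|//]]]] hj];
  rewrite /S /= ?CE ?finset.setCK ?eqxx ?(negbTE AB) ?(negbTE AA) ?(negbTE BB) ?(negbTE ABC) ?BA ?BAC.
Qed.
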